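(* Let $\nu_0,\nu_1$ be Gödel numberings (assigning numbers to the sentences of the language of $U$) and suppose $\nu_0=\eta\circ\nu_1$ for a recursive function $\eta$. Let $N$ be an interpretation of ${\sf R}$ in $U$. Then ${\sf TB}^{-\nu_0}_N\blacktriangleright_U{\sf TB}^{-\nu_1}_N$. Consequently, if $U$ is a Vaught theory that is Enayat with respect to $\nu_0$, then $U$ is Enayat with respect to $\nu_1$.
   Context: For an interpretation $N$ of ${\sf R}$ (Tarski–Mostowski–Robinson arithmetic) in $U$ with domain $\delta_N$, let $\widetilde0(x):=(x=0)$, $\widetilde{n+1}(x):=\exists y(\widetilde n(y)\wedge {\sf S}y=x)$ and, for a fresh predicate ${\sf T}$, let ${\sf T}(\underline n)$ abbreviate $\exists\vec x\in\delta_N(\widetilde n^N(\vec x)\wedge{\sf T}(\vec x))$. ${\sf TB}^{-\nu}_N$ is the set of sentences $A\leftrightarrow{\sf T}(\underline{\nu(A)})$ for $U$-sentences $A$. $\Gamma\blacktriangleright_U\Delta$ ($\Gamma$ Fujimoto interprets $\Delta$ over $U$) means there is an identity-preserving unrelativized interpretation of $U+\Delta$ in $U+\Gamma$ that is the identity on the signature of $U$. A Vaught theory is one that directly (unrelativized, identity-preserving, possibly multidimensional) interprets Vaught set theory ${\sf VS}$ ($\exists x\forall y\,y\notin x$; for each $n$, $\forall u_0\dots u_{n-1}\exists x\forall y(y\in x\leftrightarrow\bigvee_{i<n}y=u_i)$). For a Vaught theory, being Enayat w.r.t. $\nu$ means that $U$ interprets $U+{\sf TB}^{-\nu}_N$ for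 some interpretation $N$ of ${\sf R}$ (equivalently of ${\sf Succ}_0$) in $U$. *)

(* Defs.v *)
From Stdlib Require List.
From HB Require Import structures.
From mathcomp Require Import all_boot.

Set Implicit Arguments.
Unset Strict Implicit.
Unset Printing Implicit Defensive.

(* Signatures are countable, as the existence of Goedel numberings of their
   sentences presupposes.  Function symbols are allowed. *)
Record signature := Signature {
  fsym : countType;
  psym : countType;
  far : fsym -> nat;
  par : psym -> nat }.

(* Variables are de Bruijn indices. *)
Inductive term (L : signature) : Type :=
| Var of nat
| App (f : fsym L) of ('I_(far f) -> term L).

Arguments Var {L} _.
Arguments App {L} f _.

Inductive form (L : signature) : Type :=
| Bot
| Eq of term L & term L
| Rel (P : psym L) of ('I_(par P) -> term L)
| Imp of form L & form L
| All of form L.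

Arguments Bot {L}.
Arguments Eq {L} _ _.
Arguments Rel {L} P _.

Section Syntax.
Variable L : signature.
Implicit Types (A B : form L) (s t : term L).

Definition Top : form L := Imp Bot Bot.
Definition Neg A := Imp A Bot.
Definition And A B := Neg (Imp A (Neg B)).
Definition Or A B := Imp (Neg A) B.
Definition Iff A B := And (Imp A B) (Imp B A).
Definition Ex A := Neg (All (Neg A)).

Definition alls n A := iter n (@All L) A.
Definition exs n A := iter n Ex A.

Fixpoint subst_tm (sg : nat -> term L) t : term L :=
  match t with
  | Var i => sg i
  | App f ts => App f (fun i => subst_tm sg (ts i))
  end.

Definition shift_tm : term L -> term L := subst_tm (fun i => Var i.+1).

Definition up (sg : nat -> term L) (i : nat) : term L :=
  if i is j.+1 then shift_tm (sg j) else Var 0.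

Fixpoint subst (sg : nat -> term L) A : form L :=
  match A with
  | Bot => Bot
  | Eq s t => Eq (subst_tm sg s) (subst_tm sg t)
  | Rel P ts => Rel P (fun i => subst_tm sg (ts i))
  | Imp A B => Imp (subst sg A) (subst sg B)
  | All A => All (subst (up sg) A)
  end.

Definition shift : form L -> form L := subst (fun i => Var i.+1).

Definition inst t : form L -> form L :=
  subst (fun i => if i is j.+1 then Var j else t).

Fixpoint bounded_tm n t : bool :=
  match t with
  | Var i => i < n
  | App f ts => [forall i, bounded_tm n (ts i)]
  end.

Fixpoint bounded n A : bool :=
  match A with
  | Bot => true
  | Eq s t => bounded_tm n s && bounded_tm n t
  | Rel P ts => [forall i, bounded_tm n (ts i)]
  | Imp A B => bounded n A && bounded n B
  | All A => bounded n.+1 A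
  end.

Record sentence := Sentence { sform :> form L; sentence_closed : bounded 0 sform }.

Definition theory := sentence -> Prop.

Inductive nd : seq (form L) -> form L -> Prop :=
| nd_hyp G A : List.In A G -> nd G A
| nd_impI G A B : nd (A :: G) B -> nd G (Imp A B)
| nd_impE G A B : nd G (Imp A B) -> nd G A -> nd G B
| nd_raa G A : nd (Neg A :: G) Bot -> nd G A
| nd_allI G A : nd [seq shift B | B <- G] A -> nd G (All A)
| nd_allE G A t : nd G (All A) -> nd G (inst t A)
| nd_refl G t : nd G (Eq t t)
| nd_eqE G A s t : nd G (Eq s t) -> nd G (inst s A) -> nd G (inst t A).

Definition proves (T : theory) A : Prop :=
  exists2 G : seq (form L),
    forall B, List.In B G -> exists2 S : sentence, T S & B = S
  & nd G A.

End Syntax.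

Arguments Top {L}.

(* Neither injectivity nor effectiveness is required. *)
Definition goedel_numbering (L : signature) := sentence L -> nat.

(* A parameter-free [dim]-dimensional translation of [L] into [L'].  A variable
   i of [L] becomes the block of variables i * dim, ..., i * dim + dim - 1 of
   [L'].  In [tr_pred P], block i stands for the i-th argument of P; in
   [tr_func f], the graph of f, the blocks of the arguments are followed by the
   block of the value. *)
Record translation (L L' : signature) := Translation {
  dim : nat;
  dim_gt0 : 0 < dim;
  tr_dom : form L';
  tr_eq : form L';
  tr_pred : psym L -> form L';
  tr_func : fsym L -> form L';
  tr_dom_bounded : bounded dim tr_dom;
  tr_eq_bounded : bounded (2 * dim) tr_eq;
  tr_pred_bounded : forall P, bounded (par P * dim) (tr_pred P);
  tr_func_bounded : forall f, bounded ((far f).+1 * dim) (tr_func f) }.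

Section Translate.
Variables (L L' : signature) (tau : translation L L').
Local Notation m := (dim tau).

Definition dom_at k : form L' := subst (fun v => Var (k * m + v)) (tr_dom tau).

(* [val_tm d t k] : block k is the value of t, where the variables of t are
   understood to be shifted by d.  For a variable this is literal identity of
   blocks; for f(t_0, ..., t_(a-1)) it is
     exists y_0 ... y_(a-1) in the domain, each y_i being the value of t_i,
     such that block k is the tau-value of f on y_0, ..., y_(a-1). *)
Fixpoint val_tm (d : nat) (t : term L) (k : nat) : form L' :=
  match t with
  | Var x => \big[@And L'/Top]_(j < m) Eq (Var ((d + x) * m + j)) (Var (k * m + j))
  | App f ts =>
      exs (far f * m)
        (And (\big[@And L'/Top]_(i < far f)
                And (dom_at i) (val_tm (far f + d) (ts i) i))
             (subst (fun v => Var (if v < far f * m then v else v + k * m))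
                    (tr_func tau f)))
  end.

(* Atoms are unravelled: P(t_0, ..., t_(a-1)) becomes
     exists y_0 ... y_(a-1) in the domain, each y_i being the value of t_i,
     such that P_tau(y_0, ..., y_(a-1)).
   On variables (which range over the domain) this is, by pure logic,
   equivalent to P_tau applied to the corresponding blocks. *)
Fixpoint tr (A : form L) : form L' :=
  match A with
  | Bot => Bot
  | Eq s t =>
      exs (2 * m) (And (And (And (dom_at 0) (val_tm 2 s 0))
                            (And (dom_at 1) (val_tm 2 t 1)))
                       (tr_eq tau))
  | Rel P ts =>
      exs (par P * m)
        (And (\big[@And L'/Top]_(i < par P) And (dom_at i) (val_tm (par P) (ts i) i))
             (tr_pred tau P))
  | Imp A B => Imp (tr A) (tr B)
  | All A => alls m (Imp (tr_dom tau) (tr A))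
  end.

Definition interprets (V : theory L) (U : theory L') : Prop :=
  forall A : sentence L, proves V A -> proves U (tr A).

Definition unrelativized : Prop := tr_dom tau = Top.

Definition identity_preserving : Prop :=
  tr_eq tau = \big[@And L'/Top]_(j < m) Eq (Var j) (Var (m + j)).

End Translate.

Definition interpretable (L L' : signature) (V : theory L) (U : theory L') : Prop :=
  exists tau : translation L L', interprets tau V U.

Definition directly_interpretable (L L' : signature)
    (V : theory L) (U : theory L') : Prop :=
  exists tau : translation L L',
    [/\ interprets tau V U, unrelativized tau & identity_preserving tau].

Definition sig_sum (L E : signature) : signature :=
  @Signature (fsym L + fsym E)%type (psym L + psym E)%type
    (fun f => match f with inl g => far g | inr g => far g end)
    (fun P => match P with inl Q => par Q | inr Q => par Q end).

Section Embedding.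
Variables L E : signature.

Fixpoint embed_tm (t : term L) : term (sig_sum L E) :=
  match t with
  | Var i => Var i
  | App f ts => @App (sig_sum L E) (inl f) (fun i => embed_tm (ts i))
  end.

Fixpoint embed (A : form L) : form (sig_sum L E) :=
  match A with
  | Bot => Bot
  | Eq s t => Eq (embed_tm s) (embed_tm t)
  | Rel P ts => @Rel (sig_sum L E) (inl P) (fun i => embed_tm (ts i))
  | Imp A B => Imp (embed A) (embed B)
  | All A => All (embed A)
  end.

Lemma bounded_embed_tm n t : bounded_tm n (embed_tm t) = bounded_tm n t.
Proof. by elim: t => //= f ts IH; apply: eq_forallb => i; apply: IH. Qed.

Lemma bounded_embed n A : bounded n (embed A) = bounded n A.
Proof.
elim: A n => //= [s t|P ts|A IHA B IHB] n; first by rewrite !bounded_embed_tm.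
  by apply: eq_forallb => i; apply: bounded_embed_tm.
by rewrite IHA IHB.
Qed.

Lemma embed_closed (A : sentence L) : bounded 0 (embed A).
Proof. by rewrite bounded_embed; apply: sentence_closed. Qed.

Definition embed_sentence (A : sentence L) : sentence (sig_sum L E) :=
  Sentence (embed_closed A).

Definition extend (U : theory L) (Gamma : theory (sig_sum L E)) :
    theory (sig_sum L E) :=
  fun B => (exists2 A, U A & B = embed_sentence A) \/ Gamma B.

End Embedding.

Definition fixes_signature (L E1 E2 : signature)
    (F : translation (sig_sum L E2) (sig_sum L E1)) : Prop :=
  [/\ dim F = 1,
      forall P : psym L,
        tr_pred F (inl P) = @Rel (sig_sum L E1) (inl P) (fun i => Var i)
    & forall f : fsym L,
        tr_func F (inl f) =
        Eq (@App (sig_sum L E1) (inl f) (fun i => Var i)) (Var (far f))].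

Definition fujimoto (L E1 E2 : signature) (U : theory L)
    (Gamma : theory (sig_sum L E1)) (Delta : theory (sig_sum L E2)) : Prop :=
  exists F : translation (sig_sum L E2) (sig_sum L E1),
    [/\ interprets F (extend U Delta) (extend U Gamma),
        unrelativized F, identity_preserving F & fixes_signature F].

Inductive arith_fun := AZero | ASucc | AAdd | AMul.

Definition nat_of_arith_fun f :=
  match f with AZero => 0 | ASucc => 1 | AAdd => 2 | AMul => 3 end.
Definition arith_fun_of_nat n :=
  match n with 0 => AZero | 1 => ASucc | 2 => AAdd | _ => AMul end.
Lemma nat_of_arith_funK : cancel nat_of_arith_fun arith_fun_of_nat.
Proof. by case. Qed.
HB.instance Definition _ := Countable.copy arith_fun (can_type nat_of_arith_funK).

Definition arith : signature :=
  @Signature arith_fun void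
    (fun f => match f with AZero => 0 | ASucc => 1 | AAdd | AMul => 2 end)
    (of_void nat).

Section Arithmetic.
Implicit Types s t : term arith.

Definition Zero : term arith := @App arith AZero (fun _ => Var 0).
Definition Succ t : term arith := @App arith ASucc (fun _ => t).
Definition Add s t : term arith := @App arith AAdd (fun i => if i == ord0 then s else t).
Definition Mul s t : term arith := @App arith AMul (fun i => if i == ord0 then s else t).

Definition Le s t : form arith := Ex (Eq (Add (Var 0) (shift_tm s)) (shift_tm t)).

Definition numeral n : term arith := iter n Succ Zero.

End Arithmetic.

(* Tarski, Mostowski and Robinson's R, with x <= y defined by
   exists z, z + x = y. *)
Inductive R_axiom : form arith -> Prop :=
| R_add m n : R_axiom (Eq (Add (numeral m) (numeral n)) (numeral (m + n)))
| R_mul m n : R_axiom (Eq (Mul (numeral m) (numeral n)) (numeral (m * n)))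
| R_neq m n of m <> n : R_axiom (Neg (Eq (numeral m) (numeral n)))
| R_le n : R_axiom (All (Imp (Le (Var 0) (numeral n))
    (\big[@Or arith/Bot]_(i < n.+1) Eq (Var 0) (numeral i))))
| R_total n : R_axiom (All (Or (Le (Var 0) (numeral n)) (Le (numeral n) (Var 0)))).

Definition R : theory arith := fun A => R_axiom A.

(* The formula expressing "x is n", with x the variable 0. *)
Fixpoint is_numeral n : form arith :=
  if n is n'.+1 then Ex (And (is_numeral n') (Eq (Succ (Var 0)) (Var 1)))
  else Eq (Var 0) Zero.

Section Bounds.
Variable L : signature.
Implicit Types (A B : form L) (t : term L).

Lemma bounded_tm_mono n p t : n <= p -> bounded_tm n t -> bounded_tm p t.
Proof.
move=> np; elim: t => [i|f ts IH] /=; first by move/leq_trans; apply.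
by move=> /forallP h; apply/forallP => i; apply: IH.
Qed.

Lemma bounded_mono n p A : n <= p -> bounded n A -> bounded p A.
Proof.
elim: A n p => //= [s t|P ts|A IHA B IHB|A IHA] n p np.
- by move=> /andP[hs ht]; rewrite (bounded_tm_mono np hs) (bounded_tm_mono np ht).
- by move=> /forallP h; apply/forallP => i; apply: bounded_tm_mono (h i).
- by move=> /andP[hA hB]; rewrite (IHA n p np hA) (IHB n p np hB).
- exact: IHA.
Qed.

Lemma bounded_And n A B : bounded n (And A B) = bounded n A && bounded n B.
Proof. by rewrite /= !andbT. Qed.

Lemma bounded_alls n k A : bounded n (alls k A) = bounded (k + n) A.
Proof. by elim: k n => //= k IH n; rewrite IH addnS. Qed.

Lemma bounded_exs n k A : bounded n (exs k A) = bounded (k + n) A.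
Proof. by elim: k n => //= k IH n; rewrite !andbT IH addnS. Qed.

Lemma bounded_bigAnd n k (F : 'I_k -> form L) :
  (forall i, bounded n (F i)) -> bounded n (\big[@And L/Top]_(i < k) F i).
Proof.
move=> h; elim/big_ind: _ => // A B hA hB.
by rewrite bounded_And hA.
Qed.

Lemma bounded_subst_tm n p (sg : nat -> term L) t :
  (forall i, i < n -> bounded_tm p (sg i)) ->
  bounded_tm n t -> bounded_tm p (subst_tm sg t).
Proof.
move=> hs; elim: t => [i|f ts IH] /=; first exact: hs.
by move=> /forallP h; apply/forallP => i; apply: IH.
Qed.

Lemma bounded_subst n p (sg : nat -> term L) A :
  (forall i, i < n -> bounded_tm p (sg i)) ->
  bounded n A -> bounded p (subst sg A).
Proof.
elim: A n p sg => //= [s t|P ts|A IHA B IHB|A IHA] n p sg hs.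
- by move=> /andP[h1 h2]; rewrite (bounded_subst_tm hs h1) (bounded_subst_tm hs h2).
- by move=> /forallP h; apply/forallP => i; apply: bounded_subst_tm (h i).
- by move=> /andP[hA hB]; rewrite (IHA n p sg hs hA) (IHB n p sg hs hB).
- apply: IHA => -[//|i] /= hi.
  by apply: bounded_subst_tm (hs i hi) => j.
Qed.

End Bounds.

Section BoundsTranslation.
Variables (L L' : signature) (tau : translation L L').
Local Notation m := (dim tau).

Lemma block_lt N k v : k < N -> v < m -> k * m + v < N * m.
Proof.
move=> kN vm; apply: leq_trans (leq_mul kN (leqnn m)).
by rewrite mulSn addnC ltn_add2r.
Qed.

Lemma bounded_dom_at N k : k < N -> bounded (N * m) (dom_at tau k).
Proof.
move=> kN; apply: bounded_subst (tr_dom_bounded tau) => v vm /=.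
exact: block_lt.
Qed.

Lemma bounded_val_tm N d n t k : d + n <= N -> k < N -> bounded_tm n t ->
  bounded (N * m) (val_tm tau d t k).
Proof.
elim: t N d n k => [x|f ts IH] N d n k dN kN.
  move=> xn; apply: bounded_bigAnd => j /=.
  rewrite !block_lt // (leq_trans _ dN) //.
  by rewrite -addnS leq_add2l.
move=> /forallP h; rewrite /val_tm -/val_tm bounded_exs -mulnDl bounded_And.
apply/andP; split.
  apply: bounded_bigAnd => i; rewrite bounded_And bounded_dom_at /=.
    apply: (IH i _ _ n) => //; first by rewrite -addnA leq_add2l.
    exact: leq_trans (ltn_ord i) (leq_addr _ _).
  exact: leq_trans (ltn_ord i) (leq_addr _ _).
apply: bounded_subst (tr_func_bounded tau f) => v vf /=.
case: ifP => [vlt|_].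
  by apply: leq_trans vlt _; rewrite leq_mul2r leq_addr orbT.
apply: (@leq_trans ((far f).+1 * m + k * m)); first by rewrite ltn_add2r.
by rewrite -mulnDl leq_mul2r addSn -addnS leq_add2l kN orbT.
Qed.

Lemma bounded_tr n A : bounded n A -> bounded (n * m) (tr tau A).
Proof.
elim: A n => //= [s t|P ts|A IHA B IHB|A IHA] n.
- move=> /andP[hs ht]; rewrite bounded_exs -mulnDl !bounded_And.
  rewrite !bounded_dom_at // !(@bounded_val_tm _ _ n) //=.
  by apply: bounded_mono (tr_eq_bounded tau); rewrite leq_mul2r leq_addr orbT.
- move=> /forallP h; rewrite bounded_exs -mulnDl bounded_And.
  apply/andP; split.
    have lt i : (i : 'I_(par P)) < par P + n.
      exact: leq_trans (ltn_ord i) (leq_addr _ _).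
    apply: bounded_bigAnd => i; rewrite bounded_And bounded_dom_at ?lt //=.
    exact: (@bounded_val_tm _ _ n).
  by apply: bounded_mono (tr_pred_bounded tau P); rewrite leq_mul2r leq_addr orbT.
- by move=> /andP[hA hB]; rewrite IHA ?IHB.
- move=> hA; rewrite bounded_alls -mulSn /=.
  rewrite (IHA n.+1) // andbT; apply: bounded_mono (tr_dom_bounded tau).
  by rewrite mulSn leq_addr.
Qed.

End BoundsTranslation.

Lemma bounded_numeral p n : bounded_tm p (numeral n).
Proof.
elim: n => [|n IH]; first by apply/forallP => -[].
by apply/forallP.
Qed.

Lemma bounded_is_numeral n : bounded 1 (is_numeral n).
Proof.
elim: n => [|n IH] /=; first by apply/forallP => -[].
rewrite !andbT (bounded_mono _ IH) //=.
by apply/forallP.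
Qed.

Lemma R_axiom_closed A : R_axiom A -> bounded 0 A.
Proof.
have two (t u : term arith) p : bounded_tm p t -> bounded_tm p u ->
    [forall i : 'I_2, bounded_tm p (if i == ord0 then t else u)].
  by move=> ht hu; apply/forallP => i; case: ifP.
have num := bounded_numeral.
have numS p n : bounded_tm p.+1 (shift_tm (numeral n)).
  by apply: bounded_subst_tm (num p n).
case=> [m n|m n|m n _|n|n] /=; rewrite ?num ?numS ?two ?andbT //=.
by elim/big_ind: _ => // [? ? /= -> ->|i _] //=; rewrite num.
Qed.

Definition pred_sig (k : nat) : signature :=
  @Signature void unit (of_void nat) (fun _ => k).

Section TarskiBiconditionals.
Variables (L : signature) (N : translation arith L) (nu : goedel_numbering L).
Local Notation LT := (sig_sum L (pred_sig (dim N))).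

(* Under the quantifiers the variables 0, ..., dim N - 1 form block 0, the
   translation of the free variable of [is_numeral n]. *)
Definition T_num n : form LT :=
  exs (dim N)
    (And (embed _ (tr_dom N))
      (And (embed _ (tr N (is_numeral n)))
           (@Rel LT (inr tt) (fun i => Var i)))).

Definition TB_form (A : sentence L) : form LT :=
  Iff (embed _ A) (T_num (nu A)).

Lemma TB_closed A : bounded 0 (TB_form A).
Proof.
have hT n : bounded 0 (T_num n).
  rewrite bounded_exs addn0 !bounded_And !bounded_embed tr_dom_bounded.
  rewrite -{1}[dim N]mul1n bounded_tr ?bounded_is_numeral //=.
  by apply/forallP => i /=.
by rewrite /TB_form /Iff bounded_And /= hT embed_closed.
Qed.

Definition TB : theory LT := fun B => exists A, B = Sentence (TB_closed A).

End TarskiBiconditionals.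

Arguments TB {L} N nu _.

Definition set_sig : signature := @Signature void unit (of_void nat) (fun _ => 2).

Definition Mem (s t : term set_sig) : form set_sig :=
  @Rel set_sig tt (fun i => if i == ord0 then s else t).

Inductive VS_axiom : form set_sig -> Prop :=
| VS_empty : VS_axiom (Ex (All (Neg (Mem (Var 0) (Var 1)))))
| VS_adj n : VS_axiom (alls n (Ex (All (Iff (Mem (Var 0) (Var 1))
    (\big[@Or set_sig/Bot]_(i < n) Eq (Var 0) (Var i.+2)))))).

Lemma VS_axiom_closed A : VS_axiom A -> bounded 0 A.
Proof.
have mem p : bounded p.+2 (Mem (Var 0) (Var 1)).
  by apply/forallP => i; case: ifP.
case=> [|n]; first by rewrite /= !andbT; apply: mem.
rewrite bounded_alls addn0 /Ex /Iff /= -/(bounded _ (Mem _ _)).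
have or : bounded n.+2 (\big[@Or set_sig/Bot]_(i < n) Eq (Var 0) (Var i.+2)).
  by elim/big_ind: _ => // [? ? /= -> ->|i _] //=; rewrite !ltnS.
by rewrite or /= !andbT andbb; apply: (mem n).
Qed.

Definition VS : theory set_sig := fun A => VS_axiom A.

Definition vaught (L : signature) (U : theory L) : Prop :=
  directly_interpretable VS U.

Definition enayat (L : signature) (U : theory L) (nu : goedel_numbering L) : Prop :=
  exists2 N : translation arith L,
    interprets N R U & interpretable (extend U (TB N nu)) U.

(* The total recursive functions.  In [rec_prim], y ranges over the recursion argument (the first component) and
   r over the previous value.  [rec_min] is minimization of a regular function. *)
Inductive recursive : forall n, (n.-tuple nat -> nat) -> Prop :=
| rec_zero n : recursive (fun _ : n.-tuple nat => 0)
| rec_succ : recursive (fun v : 1.-tuple nat => (thead v).+1)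
| rec_proj n (i : 'I_n) : recursive (fun v => tnth v i)
| rec_comp k n (f : k.-tuple nat -> nat) (g : 'I_k -> n.-tuple nat -> nat) :
    recursive f -> (forall i, recursive (g i)) ->
    recursive (fun v => f [tuple g i v | i < k])
| rec_prim n (f : n.-tuple nat -> nat) (g : n.+2.-tuple nat -> nat) :
    recursive f -> recursive g ->
    recursive (fun v : n.+1.-tuple nat =>
      iteri (thead v)
        (fun y r => g [tuple of y :: [tuple of r :: [tuple of behead v]]])
        (f [tuple of behead v]))
| rec_min n (f : n.+1.-tuple nat -> nat) (h : n.-tuple nat -> nat) :
    recursive f ->
    (forall v, f [tuple of h v :: v] = 0 /\
               forall y, y < h v -> f [tuple of y :: v] <> 0) ->
    recursive h.

Definition recursive1 (eta : nat -> nat) : Prop :=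
  recursive (fun v : 1.-tuple nat => eta (thead v)).

(* Main.v *)
Require Import Defs.
From Stdlib Require Import Classical ClassicalEpsilon FunctionalExtensionality.
From mathcomp Require Import all_boot.
(* Undoes the shadowing of [fsym] by ssrfun. *)
Import Defs.

Set Implicit Arguments.
Unset Strict Implicit.
Unset Printing Implicit Defensive.

(** By completeness it suffices to argue in models.  Let M be a model of
    U + TB^{-nu0}_N.  Since M interprets R through N, the recursive function eta
    is represented there by some formula phi(y, x), so one can redefine the
    truth predicate by T'(x) := exists y in delta_N, phi^N(y, x) and T(y).  Then
    T'(nu1(A)) holds iff T(eta(nu1(A))) = T(nu0(A)) does, so M with T' in place
    of T is a model of U + TB^{-nu1}_N.  The second claim follows by composing
    interpretations, keeping the same N. *)

(** * Models and completeness *)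

(** The obstacle is [tr]: translations are multidimensional, unravel terms into blocks of
    existential quantifiers, and carry no laws for the translated equality and functions.
    Derivations with such formulas are avoided by replacing [interprets] with a semantic condition:
    every model of the interpreting theory defines, in the sense of [realizes], a model of the
    interpreted one. Passing from an interpretation to such structures is where completeness is
    essential: that the translated equality is a congruence and the translated functions are total
    is known only because logically valid sentences are theorems of the interpreted theory, so that
    their translations are provable.

    Models of R may have nonstandard elements, and R has no induction. Hence phi is prescribed at
    numeral inputs only, but with its output ranging over the whole model: a nonstandard y with
    phi(y, n) could make T' hold at n for the wrong reason. Minimization over all elements below y
    excludes this, and the same phi has to work in every model of R, because one translation must
    serve all models of the theory. *)

Definition scons (X : Type) (x : X) (e : nat -> X) (i : nat) : X :=
  if i is j.+1 then e j else x.

(** The environment under a block of [n] quantifiers: index 0 belongs to the innermost one, index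
    [n - 1] to the outermost. *)
Definition prepend (X : Type) n (w e : nat -> X) (i : nat) : X :=
  if i < n then w i else e (i - n).

(* Junk value [x] outside the index set. *)
Definition extend_fam (X : Type) n (x : X) (g : 'I_n -> X) (i : nat) : X :=
  if insub i is Some j then g j else x.

Lemma extend_famE (X : Type) n (x : X) (g : 'I_n -> X) (i : 'I_n) :
  extend_fam x g i = g i.
Proof. by rewrite /extend_fam valK. Qed.

Lemma prepend_lt (X : Type) n (w e : nat -> X) i : i < n -> prepend n w e i = w i.
Proof. by rewrite /prepend => ->. Qed.

Lemma prepend_add (X : Type) n (w e : nat -> X) i : prepend n w e (n + i) = e i.
Proof. by rewrite /prepend ltnNge leq_addr addKn. Qed.

(** The chosen family is defined on all of [nat], with the default [x0] past [n], so that it can be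
    used directly as an environment. *)
Lemma choice_ord (X : Type) n (Q : 'I_n -> X -> Prop) (x0 : X) :
  (forall i, exists x, Q i x) -> exists g : nat -> X, forall i, Q i (g i).
Proof.
move=> h; pose u i := sval (constructive_indefinite_description _ (h i)).
exists (extend_fam x0 u) => i; rewrite extend_famE /u.
by case: (constructive_indefinite_description _ _).
Qed.

(** * Substitution calculus for de Bruijn terms and formulas *)

Section Substitution.
Variable L : signature.
Implicit Types (A B : form L) (s t : term L).

Lemma subst_tm_comp (f g : nat -> term L) t :
  subst_tm f (subst_tm g t) = subst_tm (fun i => subst_tm f (g i)) t.
Proof.
elim: t => //= h ts IH; congr App.
by apply: functional_extensionality => i; apply: IH.
Qed.

Lemma up_comp (f g : nat -> term L) :
  (fun i => subst_tm (up f) (up g i)) = up (fun i => subst_tm f (g i)).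
Proof.
apply: functional_extensionality => -[//|i] /=.
by rewrite /shift_tm !subst_tm_comp.
Qed.

Lemma subst_comp (f g : nat -> term L) A :
  subst f (subst g A) = subst (fun i => subst_tm f (g i)) A.
Proof.
elim: A f g => //= [s t|P ts|A IHA B IHB|A IHA] f g.
- by rewrite !subst_tm_comp.
- by congr Rel; apply: functional_extensionality => i; apply: subst_tm_comp.
- by rewrite IHA IHB.
- by rewrite IHA up_comp.
Qed.

Lemma up_Var : up (@Var L) = @Var L.
Proof. by apply: functional_extensionality => -[]. Qed.

Lemma subst_tm_Var t : subst_tm (@Var L) t = t.
Proof.
elim: t => //= f ts IH; congr App.
by apply: functional_extensionality => i; apply: IH.
Qed.

Lemma subst_Var A : subst (@Var L) A = A.
Proof.
elim: A => //= [s t|P ts|A -> B ->|A IHA] //.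
- by rewrite !subst_tm_Var.
- by congr Rel; apply: functional_extensionality => i; apply: subst_tm_Var.
- by rewrite up_Var IHA.
Qed.

Lemma eq_subst_tm_bounded n (f g : nat -> term L) t :
  bounded_tm n t -> (forall i, i < n -> f i = g i) -> subst_tm f t = subst_tm g t.
Proof.
move=> bt fg; elim: t bt => [i|h ts IH] /=; first exact: fg.
move=> /forallP bt; congr App.
by apply: functional_extensionality => i; apply: IH.
Qed.

Lemma eq_subst_bounded n (f g : nat -> term L) A :
  bounded n A -> (forall i, i < n -> f i = g i) -> subst f A = subst g A.
Proof.
elim: A n f g => //= [s t|P ts|A IHA B IHB|A IHA] n f g bA fg.
- case/andP: bA => bs bt.
  by rewrite (eq_subst_tm_bounded bs fg) (eq_subst_tm_bounded bt fg).
- congr Rel; apply: functional_extensionality => i.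
  by apply: eq_subst_tm_bounded fg; apply: (forallP bA).
- by case/andP: bA => bA bB; rewrite (IHA n f g) // (IHB n f g).
- by congr All; apply: (IHA n.+1) => // -[//|i] /= lt; rewrite fg.
Qed.

Lemma inst_subst t (f : nat -> term L) A :
  inst t (subst (up f) A) = subst (scons t f) A.
Proof.
rewrite /inst subst_comp; congr subst; apply: functional_extensionality => -[//|i] /=.
by rewrite /shift_tm subst_tm_comp; apply: subst_tm_Var.
Qed.

Lemma subst_inst (f : nat -> term L) t A :
  subst f (inst t A) = inst (subst_tm f t) (subst (up f) A).
Proof.
rewrite inst_subst /inst subst_comp; congr subst.
by apply: functional_extensionality => -[].
Qed.

Lemma subst_shift (f : nat -> term L) A :
  subst (up f) (shift A) = shift (subst f A).
Proof. by rewrite /shift !subst_comp. Qed.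

Fixpoint bound_tm t : nat :=
  match t with
  | Var i => i.+1
  | App f ts => \max_i bound_tm (ts i)
  end.

(** Makes every open formula [bounded] by some number; this yields fresh variables for the Henkin
    chain and the length of a universal closure. *)
Fixpoint bound A : nat :=
  match A with
  | Bot => 0
  | Eq s t => maxn (bound_tm s) (bound_tm t)
  | Rel P ts => \max_i bound_tm (ts i)
  | Imp A B => maxn (bound A) (bound B)
  | All A => (bound A).-1
  end.

Lemma bounded_tm_bound n t : bound_tm t <= n -> bounded_tm n t.
Proof.
elim: t => //= f ts IH h; apply/forallP => i; apply: IH.
exact: leq_trans (leq_bigmax i) h.
Qed.

Lemma bounded_bound n A : bound A <= n -> bounded n A.
Proof.
elim: A n => //= [s t|P ts|A IHA B IHB|A IHA] n.
- by rewrite geq_max => /andP[h1 h2]; rewrite !bounded_tm_bound.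
- move=> h; apply/forallP => i; apply: bounded_tm_bound.
  exact: leq_trans (leq_bigmax i) h.
- by rewrite geq_max => /andP[h1 h2]; rewrite IHA ?IHB.
- by move=> h; apply: IHA; rewrite -ltnS; case: (bound A) h.
Qed.

End Substitution.

(** * Structures, satisfaction and soundness *)

Section Models.
Variable L : signature.

(* Equality is interpreted by a congruence, so no quotients are needed. *)
Record model := Model {
  carrier :> Type;
  eqv : carrier -> carrier -> Prop;
  fint : forall f : fsym L, ('I_(far f) -> carrier) -> carrier;
  pint : forall P : psym L, ('I_(par P) -> carrier) -> Prop;
  eqv_refl : forall x, eqv x x;
  eqv_sym : forall x y, eqv x y -> eqv y x;
  eqv_trans : forall x y z, eqv x y -> eqv y z -> eqv x z;
  fint_eqv : forall f u v, (forall i, eqv (u i) (v i)) -> eqv (@fint f u) (@fint f v);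
  pint_eqv : forall P u v, (forall i, eqv (u i) (v i)) -> @pint P u -> @pint P v }.

Section Sat.
Variable M : model.

Fixpoint eval (e : nat -> M) (t : term L) : M :=
  match t with
  | Var i => e i
  | App f ts => @fint M f (fun i => eval e (ts i))
  end.

Fixpoint sat (e : nat -> M) (A : form L) : Prop :=
  match A with
  | Bot => False
  | Eq s t => eqv (eval e s) (eval e t)
  | Rel P ts => @pint M P (fun i => eval e (ts i))
  | Imp A B => sat e A -> sat e B
  | All A => forall x, sat (scons x e) A
  end.

Lemma eval_subst e sg t :
  eval e (subst_tm sg t) = eval (fun i => eval e (sg i)) t.
Proof.
elim: t => //= f ts IH; congr fint.
by apply: functional_extensionality => i; apply: IH.
Qed.

Lemma sat_subst e sg A : sat e (subst sg A) <-> sat (fun i => eval e (sg i)) A.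
Proof.
elim: A e sg => //= [s t|P ts|A IHA B IHB|A IHA] e sg.
- by rewrite !eval_subst.
- have -> // : (fun i => eval e (subst_tm sg (ts i)))
             = (fun i => eval (fun i => eval e (sg i)) (ts i)).
  by apply: functional_extensionality => i; apply: eval_subst.
- by rewrite IHA IHB.
- split=> h x; move: (h x); rewrite IHA.
    have -> // : (fun i => eval (scons x e) (up sg i))
               = scons x (fun i => eval e (sg i)).
    by apply: functional_extensionality => -[//|i] /=; rewrite /shift_tm eval_subst.
  have -> // : (fun i => eval (scons x e) (up sg i))
             = scons x (fun i => eval e (sg i)).
  by apply: functional_extensionality => -[//|i] /=; rewrite /shift_tm eval_subst.
Qed.

Lemma eval_bounded n e e' t : bounded_tm n t ->
  (forall i, i < n -> eqv (e i) (e' i)) -> eqv (eval e t) (eval e' t).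
Proof.
move=> bt ee; elim: t bt => [i|f ts IH] /=; first exact: ee.
by move=> /forallP bt; apply: fint_eqv => i; apply: IH.
Qed.

(** This takes the place of a quotient: satisfaction does not see which representative of an [eqv]
    class is used. Both directions go through the induction together because [Imp] is
    contravariant. *)
Lemma sat_bounded_imp n e e' A : bounded n A ->
  (forall i, i < n -> eqv (e i) (e' i)) -> (sat e A -> sat e' A) /\ (sat e' A -> sat e A).
Proof.
elim: A n e e' => //= [s t|P ts|A IHA B IHB|A IHA] n e e' bA ee.
- case/andP: bA => bs bt.
  have es := eval_bounded bs ee; have et := eval_bounded bt ee.
  split=> h; first exact: eqv_trans (eqv_sym es) (eqv_trans h et).
  exact: eqv_trans es (eqv_trans h (eqv_sym et)).
- have ets i : eqv (eval e (ts i)) (eval e' (ts i)).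
    by apply: eval_bounded ee; apply: (forallP bA).
  by split; apply: pint_eqv => i; [| apply: eqv_sym].
- case/andP: bA => bA bB.
  by case: (IHA _ _ _ bA ee) (IHB _ _ _ bB ee) => a1 a2 [b1 b2]; split; auto.
- have ee' x i : i < n.+1 -> eqv (scons x e i) (scons x e' i).
    by case: i => [_|i] /=; [apply: eqv_refl | apply: ee].
  by split=> h x; have := h x; case: (IHA _ _ _ bA (ee' x)).
Qed.

Lemma sat_bounded n e e' A : bounded n A ->
  (forall i, i < n -> eqv (e i) (e' i)) -> sat e A <-> sat e' A.
Proof. by move=> bA ee; case: (sat_bounded_imp bA ee). Qed.

Lemma sat_closed e e' A : bounded 0 A -> sat e A <-> sat e' A.
Proof. by move/sat_bounded; apply. Qed.

Lemma sat_eqv e e' A : (forall i, eqv (e i) (e' i)) -> sat e A <-> sat e' A.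
Proof. by move=> ee; apply: sat_bounded (bounded_bound (leqnn _)) _. Qed.

Lemma sat_And e A B : sat e (And A B) <-> sat e A /\ sat e B.
Proof. by rewrite /=; split; [move=> h; split; apply: NNPP; tauto | tauto]. Qed.

Lemma sat_Or e A B : sat e (Or A B) <-> sat e A \/ sat e B.
Proof. by rewrite /=; split; [move=> h; apply: NNPP; tauto | tauto]. Qed.

Lemma sat_Iff e A B : sat e (Iff A B) <-> (sat e A <-> sat e B).
Proof. by rewrite /Iff sat_And /=; tauto. Qed.

Lemma sat_Ex e A : sat e (Ex A) <-> exists x, sat (scons x e) A.
Proof.
split=> /= [h|[x hx] h]; last exact: h hx.
by apply: NNPP => h'; apply: h => x hx; apply: h'; exists x.
Qed.

Lemma prepend_scons n (w e : nat -> M) :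
  prepend n w (scons (w n) e) = prepend n.+1 w e.
Proof.
apply: functional_extensionality => i; rewrite /prepend ltnS.
case: (ltngtP i n) => [//||->]; last by rewrite subnn.
by case: i => // i lt; rewrite subSn.
Qed.

Lemma sat_alls n e A : sat e (alls n A) <-> forall w, sat (prepend n w e) A.
Proof.
elim: n e => [|n IH] e.
  have e0 w : prepend 0 w e = e.
    by apply: functional_extensionality => i; rewrite /prepend subn0.
  by split=> [h w|/(_ e)]; rewrite e0.
have -> : sat e (alls n.+1 A) = forall x, sat (scons x e) (alls n A) by [].
split=> [h w|h x]; first by rewrite -prepend_scons; exact: (proj1 (IH _) (h (w n))).
(* [prepend n] reads [w] only below [n], so position [n] is free to carry the value of the outermost
   quantifier. *)
apply: (proj2 (IH _)) => w; pose w' i := if i < n then w i else x.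
have := h w'; rewrite -prepend_scons {2}/w' ltnn.
congr sat; apply: functional_extensionality => i.
by rewrite /prepend /w'; case: ifP => // ->.
Qed.

Lemma sat_exs n e A : sat e (exs n A) <-> exists w, sat (prepend n w e) A.
Proof.
elim: n e => [|n IH] e.
  have e0 w : prepend 0 w e = e.
    by apply: functional_extensionality => i; rewrite /prepend subn0.
  by split=> [h|[w]]; [exists e|]; rewrite e0.
have -> : exs n.+1 A = Ex (exs n A) by [].
rewrite sat_Ex; split=> [[x /IH[w hw]]|[w hw]]; last first.
  by exists (w n); apply/IH; exists w; rewrite prepend_scons.
pose w' i := if i < n then w i else x.
exists w'; rewrite -prepend_scons {2}/w' ltnn.
move: hw; congr sat; apply: functional_extensionality => i.
by rewrite /prepend /w'; case: ifP => // ->.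
Qed.

Lemma sat_bigAnd e n (F : 'I_n -> form L) :
  sat e (\big[@And L/Top]_(i < n) F i) <-> forall i, sat e (F i).
Proof.
elim: n F => [|n IH] F; first by rewrite big_ord0; split=> [_ [] //|_ /= f].
rewrite big_ord_recl sat_And IH; split=> [[h0 h] i|h //].
by case: (unliftP ord0 i) => [j|] ->.
Qed.

Lemma sat_bigOr e n (F : 'I_n -> form L) :
  sat e (\big[@Or L/Bot]_(i < n) F i) <-> exists i, sat e (F i).
Proof.
elim: n F => [|n IH] F; first by rewrite big_ord0; split=> [[]|[[]]].
rewrite big_ord_recl sat_Or IH; split=> [[h|[i h]]|[i]]; first by exists ord0.
  by exists (lift ord0 i).
by case: (unliftP ord0 i) => [j|] -> h; [right; exists j | left].
Qed.

Lemma nd_sound G A : nd G A ->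
  forall e, (forall B, List.In B G -> sat e B) -> sat e A.
Proof.
elim=> {G A} [G A iA|G A B _ IH|G A B _ IH1 _ IH2|G A _ IH|G A _ IH|G A t _ IH
  |G t|G A s t _ IH1 _ IH2] e hG.
- exact: hG.
- by move=> /= hA; apply: IH => C [<-|/hG].
- exact: IH1 (IH2 _ hG).
- by apply: NNPP => h; apply: (IH e) => C [<-|/hG].
- move=> /= x; apply: IH => B hB.
  have {hB}[C iC ->] : exists2 C, List.In C G & B = shift C.
    elim: G hB {hG} => //= C G IHG [<-|/IHG[D iD ->]]; first by exists C; [left|].
    by exists D; [right|].
  by apply/sat_subst; apply: hG.
- apply/sat_subst; move: (IH e hG (eval e t)); apply: iffLR; apply: sat_eqv.
  by case=> [|i]; apply: eqv_refl.
- exact: eqv_refl.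
- apply/sat_subst; move/sat_subst: (IH2 e hG).
  by apply: iffLR; apply: sat_eqv => -[|i]; [apply: IH1 | apply: eqv_refl].
Qed.

Definition models (T : theory L) : Prop :=
  forall A : sentence L, T A -> forall e, sat e A.

Lemma proves_sound (T : theory L) A : models T -> proves T A -> forall e, sat e A.
Proof.
move=> MT [G GT ndA] e; apply: nd_sound ndA _ _ => B /GT[S TS ->]; exact: MT.
Qed.

End Sat.
End Models.

(** * Enumeration of formulas *)

Section Countability.
Variable L : signature.

Let letter := (nat + fsym L + psym L)%type.

(** Arguments are functions on an ordinal; listing them through [enum] embeds terms into finite
    trees over a countable alphabet, which are countable. *)
Fixpoint code_tm (t : term L) : GenTree.tree letter :=
  match t with
  | Var i => GenTree.Leaf (inl (inl i))
  | App f ts => GenTree.Node 0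
      (GenTree.Leaf (inl (inr f)) :: [seq code_tm (ts i) | i <- enum 'I_(far f)])
  end.

Lemma code_tm_inj : injective code_tm.
Proof.
elim=> [i|f ts IH] [j|g us] //=; first by case=> ->.
case=> fg; move: fg us => <- us /eq_in_map E; congr App.
by apply: functional_extensionality => i; apply/IH/E; rewrite mem_enum.
Qed.

Fixpoint code (A : form L) : GenTree.tree letter :=
  match A with
  | Bot => GenTree.Node 0 [::]
  | Eq s t => GenTree.Node 1 [:: code_tm s; code_tm t]
  | Rel P ts => GenTree.Node 2
      (GenTree.Leaf (inr P) :: [seq code_tm (ts i) | i <- enum 'I_(par P)])
  | Imp A B => GenTree.Node 3 [:: code A; code B]
  | All A => GenTree.Node 4 [:: code A]
  end.

Lemma code_inj : injective code.
Proof.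
elim=> [|s t|P ts|A IHA B IHB|A IHA] [|s' t'|P' ts'|A' B'|A'] //=.
- by case=> /code_tm_inj -> /code_tm_inj ->.
- case=> PP; move: PP ts' => <- us /eq_in_map E; congr Rel.
  by apply: functional_extensionality => i; apply/code_tm_inj/E; rewrite mem_enum.
- by case=> /IHA -> /IHB ->.
- by case=> /IHA ->.
Qed.

Lemma form_enumeration : exists en : nat -> form L, forall A, exists n, en n = A.
Proof.
have h n : exists A : form L, (exists B, pickle (code B) = n) -> pickle (code A) = n.
  by case: (classic (exists B, pickle (code B) = n)) => [[B <-]|no]; [exists B | exists Bot].
exists (fun n => sval (constructive_indefinite_description _ (h n))) => A.
exists (pickle (code A)); case: (constructive_indefinite_description _ _) => /= B hB.
by apply/code_inj/(pcan_inj pickleK)/hB; exists A.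
Qed.

End Countability.

(** * Henkin construction with variables as witnesses *)

Section Completeness.
Variable L : signature.
Implicit Types (A B C : form L) (X Y : form L -> Prop).

Lemma In_map (S S' : Type) (f : S -> S') (G : seq S) y :
  List.In y [seq f x | x <- G] <-> exists2 x, List.In x G & y = f x.
Proof.
elim: G => [|a G IH] /=; first by split=> // -[].
rewrite IH; split=> [[<-|[x ix ->]]|[x [->|ix] ->]].
- by exists a; [left|].
- by exists x; [right|].
- by left.
- by right; exists x.
Qed.

Lemma nd_weaken (G G' : seq (form L)) A :
  nd G A -> (forall B, List.In B G -> List.In B G') -> nd G' A.
Proof.
move=> h; elim: h G' => {G A} [G A iA|G A B _ IH|G A B _ IH1 _ IH2|G A _ IH|G A _ IH
  |G A t _ IH|G t|G A s t _ IH1 _ IH2] G' sub.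
- by apply: nd_hyp; apply: sub.
- by apply: nd_impI; apply: IH => C /= [|/sub]; auto.
- by apply: nd_impE (IH1 _ sub) (IH2 _ sub).
- by apply: nd_raa; apply: IH => C /= [|/sub]; auto.
- by apply: nd_allI; apply: IH => B /In_map[C /sub iC ->]; apply/In_map; exists C.
- by apply: nd_allE; apply: IH.
- exact: nd_refl.
- by apply: nd_eqE (IH1 _ sub) (IH2 _ sub).
Qed.

(** Serves to rename a Henkin variable into a bound one. *)
Lemma nd_subst (G : seq (form L)) A sg :
  nd G A -> nd [seq subst sg B | B <- G] (subst sg A).
Proof.
move=> h; elim: h sg => {G A} [G A iA|G A B _ IH|G A B _ IH1 _ IH2|G A _ IH|G A _ IH
  |G A t _ IH|G t|G A s t _ IH1 _ IH2] sg.
- by apply: nd_hyp; apply/In_map; exists A.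
- by apply: nd_impI; apply: IH.
- exact: nd_impE (IH1 _) (IH2 _).
- by apply: nd_raa; apply: IH.
- apply: nd_allI; have := IH (up sg); rewrite -!map_comp.
  by congr nd; apply: eq_map => B /=; apply: subst_shift.
- by rewrite subst_inst; apply: nd_allE; apply: IH.
- exact: nd_refl.
- have := IH2 sg; rewrite !subst_inst; apply: nd_eqE; exact: IH1.
Qed.

Definition derives X A : Prop :=
  exists2 G, forall B, List.In B G -> X B & nd G A.

Definition add X A : form L -> Prop := fun B => X B \/ B = A.

Definition consistent X : Prop := ~ derives X Bot.

Lemma derives_hyp X A : X A -> derives X A.
Proof. by exists [:: A]; [move=> B [<-|[]] | apply: nd_hyp; left]. Qed.

Lemma derives_mono X Y A : (forall B, X B -> Y B) -> derives X A -> derives Y A.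
Proof. by move=> sub [G GX ndA]; exists G => // B /GX/sub. Qed.

Lemma derives_impE X A B : derives X (Imp A B) -> derives X A -> derives X B.
Proof.
case=> G GX h [G' GX' h']; exists (G ++ G') => [C|].
  by rewrite List.in_app_iff; case; auto.
by apply: (@nd_impE _ _ A); [apply: nd_weaken h _ | apply: nd_weaken h' _] => C;
  rewrite List.in_app_iff; auto.
Qed.

Lemma nd_add X A B G : (forall C, List.In C G -> add X A C) -> nd G B ->
  exists2 G', forall C, List.In C G' -> X C & nd (A :: G') B.
Proof.
move=> GX ndB.
have [G' GX' sub] : exists2 G', forall C, List.In C G' -> X C &
    forall C, List.In C G -> List.In C (A :: G').
  elim: G GX {ndB} => [|C G IH] GX; first by exists [::].
  have [D iD|G' GX' sub] := IH; first by apply: GX; right.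
  case: (GX C (or_introl erefl)) => [XC|->].
    exists (C :: G') => D /= [<-|]; auto.
    by move/sub => /= -[]; auto.
  by exists G' => // D /= [<-|/sub]; auto.
by exists G' => //; apply: nd_weaken ndB sub.
Qed.

Lemma derives_impI X A B : derives (add X A) B -> derives X (Imp A B).
Proof. by case=> G /nd_add h /h[G' GX' h']; exists G' => //; apply: nd_impI. Qed.

Lemma derives_raa X A : derives (add X (Neg A)) Bot -> derives X A.
Proof. by case=> G /nd_add h /h[G' GX' h']; exists G' => //; apply: nd_raa. Qed.

(** Generalization over a named fresh variable [x], whereas [nd_allI] generalizes over index 0 of a
    shifted context. *)
Lemma derives_allI X A x : (forall B, X B -> bounded x B) -> bounded x.+1 A ->
  derives X (inst (Var x) A) -> derives X (All A).
Proof.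
move=> bX bA [G GX ndA]; exists G => //; apply: nd_allI.
(* Renames [x] to 0 and shifts the rest. On formulas with variables below [x] it acts as [shift],
   and it turns the instance at [x] back into [A]. *)
pose sg i : term L := if i == x then Var 0 else Var i.+1.
have := nd_subst sg ndA.
have -> : subst sg (inst (Var x) A) = A.
  rewrite /inst subst_comp -[RHS]subst_Var; apply: (eq_subst_bounded bA) => -[|i] /=.
    by rewrite /sg eqxx.
  by rewrite ltnS /sg => /ltn_eqF ->.
congr nd; elim: G GX {ndA} => //= B G IH GX; rewrite IH => [|C iC]; last by apply: GX; right.
congr cons; apply: (@eq_subst_bounded _ x); first by apply: bX; apply: GX; left.
by move=> i lt; rewrite /sg ltn_eqF.
Qed.

Variable X0 : form L -> Prop.
Variable b0 : nat.
Hypothesis X0_bounded : forall B, X0 B -> bounded b0 B.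
Hypothesis X0_consistent : consistent X0.
Variable en : nat -> form L.
Hypothesis en_surj : forall A, exists n, en n = A.

(** Dominates the variables of [en n] and of [chain n]; the strict growth keeps the witness
    [fresh n] itself below [fresh n.+1]. *)
Fixpoint fresh n : nat :=
  maxn (bound (en n)) (if n is n'.+1 then (fresh n').+1 else b0).

(* Henkin witnesses are fresh variables. *)
Fixpoint chain n : form L -> Prop :=
  if n is n'.+1 then fun C =>
    chain n' C \/
    consistent (add (chain n') (en n')) /\
    (C = en n' \/
     exists2 D, en n' = Neg (All D) & C = Neg (inst (Var (fresh n')) D))
  else X0.

Lemma bounded_en n : bounded (fresh n) (en n).
Proof. by apply: bounded_bound; case: n => [|n] /=; apply: leq_maxl. Qed.

Lemma chain_bounded n C : chain n C -> bounded (fresh n) C.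
Proof.
elim: n C => [|n IH] C; first by move/X0_bounded/bounded_mono; apply; apply: leq_maxr.
have lt : fresh n < fresh n.+1 by apply: leq_maxr.
case=> [/IH/bounded_mono|[_ [->|[D eD ->]]]]; first by apply; apply: ltnW.
  exact: bounded_mono (ltnW lt) (bounded_en n).
have := bounded_en n; rewrite eD /= !andbT => bD.
apply: bounded_subst bD => -[|i] //=; rewrite ltnS => li.
exact: ltn_trans li lt.
Qed.

(** Only a witness for [Neg (All D)] can do harm. If adding it gives a contradiction, then [D] at
    the fresh variable is derivable, hence so is [All D], and [en n] was already inconsistent with
    [chain n]. *)
Lemma chain_consistent n : consistent (chain n).
Proof.
elim: n => [//|n IH].
case: (classic (consistent (add (chain n) (en n)))) => con; last first.
  by move=> h; apply: IH; apply: derives_mono h => C [//|[]].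
case: (classic (exists D, en n = Neg (All D))) => [[D eD]|no]; last first.
  move=> h; apply: con; apply: derives_mono h => C [hC|[_ [->|[D eD _]]]].
  - by left.
  - by right.
  - by case: no; exists D.
move=> h; apply: con.
have bD := bounded_en n; rewrite eD /= !andbT in bD.
have bX B : add (chain n) (en n) B -> bounded (fresh n) B.
  by case=> [/chain_bounded|->] //; apply: bounded_en.
apply: (@derives_impE _ (All D)); first by apply: derives_hyp; right.
apply: (derives_allI bX bD); apply: derives_raa.
apply: derives_mono h => C [hC|[_ [->|[D' eD' ->]]]]; first by left; left.
  by left; right.
by right; move: eD'; rewrite eD => -[->].
Qed.

Lemma chain_mono n k C : n <= k -> chain n C -> chain k C.
Proof.
move=> /subnK <-; elim: (k - n) => //= j IH hC; left; exact: IH.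
Qed.

Definition henkin C : Prop := exists n, chain n C.

Lemma henkin_consistent : consistent henkin.
Proof.
case=> G GX ndB.
have [n hn] : exists n, forall C, List.In C G -> chain n C.
  elim: G GX {ndB} => [|C G IH] GX; first by exists 0.
  have [|n hn] := IH; first by move=> D iD; apply: GX; right.
  have [|k hk] := GX C; first by left.
  exists (maxn n k) => D [<-|/hn]; last exact: chain_mono (leq_maxl n k).
  exact: chain_mono (leq_maxr n k) hk.
by case: (@chain_consistent n); exists G.
Qed.

(** No separate maximal extension is required: the chain also decides each formula when its turn in
    the enumeration comes. *)
Lemma henkin_max A : consistent (add henkin A) -> henkin A.
Proof.
move=> con; have [n en_n] := en_surj A; exists n.+1; right; split; last by left.
by rewrite en_n => h; apply: con; apply: derives_mono h => C [hC|->];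
  [left; exists n | right].
Qed.

Lemma henkin_derives A : derives henkin A -> henkin A.
Proof.
move=> h; apply: henkin_max => /derives_impI h'.
exact: henkin_consistent (derives_impE h' h).
Qed.

Lemma henkin_Imp A B : henkin (Imp A B) <-> (henkin A -> henkin B).
Proof.
split=> [hAB hA|h].
  by apply: henkin_derives; apply: (@derives_impE _ A); apply: derives_hyp.
apply: henkin_derives; apply: derives_impI.
case: (classic (henkin A)) => hA; first by apply: derives_hyp; left; apply: h.
have [|//] := classic (consistent (add henkin A)); first by move/henkin_max.
move=> /NNPP[G GX ndB]; exists G => //; apply: nd_raa; apply: nd_weaken ndB _.
by move=> C iC; right.
Qed.

Lemma henkin_Bot : ~ henkin Bot.
Proof. by move=> h; apply: henkin_consistent; apply: derives_hyp. Qed.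

(** For the converse, a failing [All A] puts its negation into the set, and the stage that
    enumerates this negation has added a refuted instance. *)
Lemma henkin_All A : henkin (All A) <-> forall t, henkin (inst t A).
Proof.
split=> [hA t|h].
  apply: henkin_derives; have [G GX ndA] := derives_hyp hA.
  by exists G => //; apply: nd_allE.
apply: NNPP => no.
have hN : henkin (Neg (All A)) by apply/henkin_Imp.
have [n en_n] := en_surj (Neg (All A)).
have : henkin (Neg (inst (Var (fresh n)) A)).
  exists n.+1; right; split; last by right; exists A.
  rewrite en_n => h'; apply: henkin_consistent; apply: derives_mono h' => C [hC|->] //.
  by exists n.
by move/henkin_Imp => /(_ (h _)) /henkin_Bot.
Qed.

Lemma henkin_refl t : henkin (Eq t t).
Proof. by apply: henkin_derives; exists [::] => //; apply: nd_refl. Qed.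

Lemma henkin_eqE A s t : henkin (Eq s t) -> henkin (inst s A) -> henkin (inst t A).
Proof.
move=> hE hA; apply: henkin_derives; exists [:: Eq s t; inst s A].
  by move=> B /= [<-|[<-|[]]].
by apply: (@nd_eqE _ _ _ s); apply: nd_hyp => /=; auto.
Qed.

(** [nd_eqE] replaces one term. Here [h k] has the first [k] variables already replaced, and after
    [bound A] steps no free variable of [A] is left. *)
Lemma henkin_subst (f g : nat -> term L) A : (forall i, henkin (Eq (f i) (g i))) ->
  henkin (subst f A) -> henkin (subst g A).
Proof.
move=> fg hf; pose h k i := if i < k then g i else f i.
have hk k : henkin (subst (h k) A).
  elim: k => [//|k IH].
  (* Marks the variable [k] being replaced by index 0, so that both neighbours [h k] and [h k.+1]
     are instances of one formula. *)
  pose c i : term L := if i == k then Var 0 else shift_tm (h k i).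
  have inst_c t : inst t (subst c A) = subst (fun i => if i == k then t else h k i) A.
    rewrite /inst subst_comp; congr subst; apply: functional_extensionality => i.
    rewrite /c; case: ifP => // _; rewrite /shift_tm subst_tm_comp.
    exact: subst_tm_Var.
  have -> : subst (h k.+1) A = inst (g k) (subst c A).
    rewrite inst_c; congr subst; apply: functional_extensionality => i.
    by rewrite /h ltnS leq_eqVlt; case: (altP (i =P k)) => [->|].
  apply: (henkin_eqE (fg k)); rewrite inst_c; move: IH; congr henkin.
  congr subst; apply: functional_extensionality => i.
  by rewrite /h; case: (altP (i =P k)) => [->|]; rewrite ?ltnn.
have := hk (bound A); congr henkin.
by apply: (eq_subst_bounded (bounded_bound (leqnn _))) => i lt; rewrite /h lt.
Qed.

Let heq s t := henkin (Eq s t).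

Lemma henkin_sym s t : heq s t -> heq t s.
Proof.
move=> st; pose f x i : term L := if i == 0 then x else s.
have := @henkin_subst (f s) (f t) (Eq (Var 0) (Var 1)).
by apply=> [[|i]|]; rewrite /f //=; apply: henkin_refl.
Qed.

Lemma henkin_trans s t u : heq s t -> heq t u -> heq s u.
Proof.
move=> st tu; pose f x i : term L := if i == 0 then s else x.
have := @henkin_subst (f t) (f u) (Eq (Var 0) (Var 1)).
by apply=> [[|i]|]; rewrite /f //=; apply: henkin_refl.
Qed.

Lemma henkin_App f (u v : 'I_(far f) -> term L) :
  (forall i, heq (u i) (v i)) -> heq (App f u) (App f v).
Proof.
move=> uv; pose n := far f.
(* The first [n] variables stay filled with [u], the next [n] receive [u] or [w]; at [u] the
   equation [A] is reflexivity. *)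
pose sg (w : 'I_n -> term L) := prepend n (extend_fam (Var 0) u) (extend_fam (Var 0) w).
pose A : form L := Eq (App f (fun i : 'I_n => Var i)) (App f (fun i : 'I_n => Var (n + i))).
have E w : subst (sg w) A = Eq (App f u) (App f w).
  rewrite /A /=; congr Eq; congr App; apply: functional_extensionality => i.
    by rewrite /sg prepend_lt // extend_famE.
  by rewrite /sg prepend_add extend_famE.
rewrite /heq -E; apply: (@henkin_subst (sg u)); last by rewrite E; apply: henkin_refl.
move=> i; rewrite /sg /prepend; case: ifP => _; first exact: henkin_refl.
by rewrite /extend_fam; case: insubP => [j _ _|_]; [apply: uv | apply: henkin_refl].
Qed.

Lemma henkin_Rel P (u v : 'I_(par P) -> term L) :
  (forall i, heq (u i) (v i)) -> henkin (Rel P u) -> henkin (Rel P v).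
Proof.
move=> uv; pose A : form L := Rel P (fun i => Var i).
have E w : subst (extend_fam (Var 0) w) A = Rel P w.
  by congr Rel; apply: functional_extensionality => i; apply: extend_famE.
rewrite -!E; apply: henkin_subst => i.
by rewrite /extend_fam; case: insubP => [j _ _|_]; [apply: uv | apply: henkin_refl].
Qed.

Definition henkin_model : model L :=
  @Model L (term L) heq (@App L) (fun P ts => henkin (Rel P ts))
    henkin_refl henkin_sym henkin_trans henkin_App henkin_Rel.

Lemma sat_henkin (e : nat -> henkin_model) A : sat e A <-> henkin (subst e A).
Proof.
elim: A e => /= [|s t|P ts|A IHA B IHB|A IHA] e.
- by split=> // /henkin_Bot.
- by [].
- by [].
- by rewrite IHA IHB henkin_Imp.
- rewrite henkin_All; split=> h t; move: (h t); rewrite inst_subst IHA //.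
Qed.

End Completeness.

(** The formula may be open: variables are elements of the term model, the environment [Var] sends
    each to itself, and [bound A] keeps them out of the supply of witnesses. *)
Theorem completeness (L : signature) (T : theory L) (A : form L) :
  (forall (M : model L) (e : nat -> M), models M T -> sat e A) -> proves T A.
Proof.
move=> valid; apply: NNPP => unprov.
pose TT (B : form L) := exists2 S : sentence L, T S & B = S.
pose X0 := add TT (Neg A).
have con : consistent X0.
  by move=> /derives_raa h; apply: unprov; case: h => G GT ndA; exists G.
have bX B : X0 B -> bounded (bound A) B.
  case=> [[S _ ->]|->]; first exact: bounded_mono (leq0n _) (sentence_closed S).
  by rewrite /= bounded_bound.
have [en en_surj] := form_enumeration L.
pose M := henkin_model bX con en_surj.
pose e : nat -> M := @Var L.
have hX B : X0 B -> sat e B.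
  by move=> XB; apply/sat_henkin; rewrite subst_Var; exists 0.
have MT : models M T.
  move=> S TS e'; apply/(sat_closed e e' (sentence_closed S)).
  by apply: hX; left; exists S.
have hN : sat e (Neg A) by apply: hX; right.
exact: hN (valid M e MT).
Qed.

(** * Translations in models *)

(** Flattens a sequence of tuples according to the variable convention of [translation]: entry [j]
    of tuple [i] is the value of variable [i * m + j]. *)
Definition blocks (X : Type) m (es : nat -> nat -> X) (v : nat) : X :=
  es (v %/ m) (v %% m).

Lemma blocks_at (X : Type) m (es : nat -> nat -> X) k j :
  j < m -> blocks m es (k * m + j) = es k j.
Proof.
move=> jm; have m0 : 0 < m by case: m jm.
by rewrite /blocks divnMDl // divn_small // addn0 modnMDl modn_small.
Qed.

Lemma blocks_split (X : Type) m (w : nat -> X) :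
  blocks m (fun i j => w (i * m + j)) = w.
Proof. by apply: functional_extensionality => v; rewrite /blocks -divn_eq. Qed.

Lemma prepend_blocks (X : Type) m a (ys es : nat -> nat -> X) : 0 < m ->
  prepend (a * m) (blocks m ys) (blocks m es) = blocks m (prepend a ys es).
Proof.
move=> m0; apply: functional_extensionality => v.
rewrite /prepend /blocks ltn_divLR //; case: ltnP => // le.
by rewrite -{3 4}(subnKC le) divnMDl // modnMDl addKn.
Qed.

Lemma prepend_blocks_succ (X : Type) m n (es : nat -> nat -> X) e :
  prepend (n * m) (blocks m es) (prepend m (es n) e) = prepend (n.+1 * m) (blocks m es) e.
Proof.
apply: functional_extensionality => v; rewrite /prepend mulSn.
case: (ltnP v (n * m)) => [lt|le]; first by rewrite (leq_trans lt (leq_addl _ _)).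
rewrite ltn_subLR // addnC; case: ifP => [lt|_].
  by rewrite -{2}(subnKC le) blocks_at // ltn_subLR // addnC.
by rewrite -subnDA addnC.
Qed.

(** * Meaning of translated formulas for an arbitrary translation *)

Section TranslationSemantics.
Variables (L L' : signature) (tau : translation L L') (M : model L').
Local Notation m := (dim tau).
Implicit Types (es ys : nat -> nat -> M) (v w : nat -> M).

Lemma sat_blocks n es es' A : bounded (n * m) A ->
  (forall i j, i < n -> j < m -> eqv (es i j) (es' i j)) ->
  sat (blocks m es) A <-> sat (blocks m es') A.
Proof.
move=> bA ee; apply: (sat_bounded bA) => v lt; apply: ee.
  by rewrite ltn_divLR ?dim_gt0.
by rewrite ltn_mod dim_gt0.
Qed.

Lemma sat_exs_blocks k es A :
  sat (blocks m es) (exs (k * m) A) <-> exists ys, sat (blocks m (prepend k ys es)) A.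
Proof.
rewrite sat_exs; split=> [[w]|[ys]].
  by rewrite -(blocks_split m w) prepend_blocks ?dim_gt0 // => h; eexists; apply: h.
by rewrite -prepend_blocks ?dim_gt0 // => h; eexists; apply: h.
Qed.

Definition in_dom v : Prop := sat v (tr_dom tau).

Lemma in_dom_eqv v w : (forall j, j < m -> eqv (v j) (w j)) -> in_dom v <-> in_dom w.
Proof. exact: sat_bounded (tr_dom_bounded tau). Qed.

Lemma sat_dom_at es k : sat (blocks m es) (dom_at tau k) <-> in_dom (es k).
Proof.
rewrite sat_subst; apply: in_dom_eqv => j jm /=.
by rewrite blocks_at //; apply: eqv_refl.
Qed.

Definition tr_graph f ys w : Prop :=
  sat (blocks m (prepend (far f) ys (fun _ => w))) (tr_func tau f).

Definition tr_eqv v w : Prop := sat (blocks m (scons v (fun _ => w))) (tr_eq tau).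

Lemma tr_graph_eqv f ys ys' w w' :
  (forall (i : 'I_(far f)) j, j < m -> eqv (ys i j) (ys' i j)) ->
  (forall j, j < m -> eqv (w j) (w' j)) -> tr_graph f ys w <-> tr_graph f ys' w'.
Proof.
move=> eys ew; apply: sat_blocks (tr_func_bounded tau f) _ => i j _ jm.
rewrite /prepend; case: ifP => lt; last exact: ew.
exact: (eys (Ordinal lt)).
Qed.

Lemma tr_eqv_eqv v v' w w' :
  (forall j, j < m -> eqv (v j) (v' j)) -> (forall j, j < m -> eqv (w j) (w' j)) ->
  tr_eqv v w <-> tr_eqv v' w'.
Proof.
by move=> ev ew; apply: sat_blocks (tr_eq_bounded tau) _ => -[|i] j _ jm;
  [apply: ev | apply: ew].
Qed.

(** The relation defined by [val_tm], without its index offsets. It is only a relation: for an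
    arbitrary translation a term may have no value or several. *)
Fixpoint tm_value es (t : term L) w : Prop :=
  match t with
  | Var x => forall j, j < m -> eqv (es x j) (w j)
  | App f ts => exists2 ys : nat -> nat -> M,
      forall i : 'I_(far f), in_dom (ys i) /\ tm_value es (ts i) (ys i) & tr_graph f ys w
  end.

Lemma sat_val_tm t d k es :
  sat (blocks m es) (val_tm tau d t k) <-> tm_value (fun i => es (d + i)) t (es k).
Proof.
elim: t d k es => [x|f ts IH] d k es.
  rewrite [val_tm _ _ _ _]/= sat_bigAnd /=; split=> [h j jm|h j].
    by have := h (Ordinal jm); rewrite /= !blocks_at.
  by rewrite !blocks_at //; apply: h.
rewrite [val_tm _ _ _ _]/= sat_exs_blocks /=.
have E ys : (fun i => prepend (far f) ys es (far f + d + i)) = fun i => es (d + i).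
  by apply: functional_extensionality => i; rewrite -addnA prepend_add.
(* In [val_tm] the value block, number [far f], is moved to [far f + k]; behind the [far f]
   quantified blocks this is the old block [k]. *)
have G ys : sat (blocks m (prepend (far f) ys es))
    (subst (fun i => Var (if i < far f * m then i else i + k * m)) (tr_func tau f))
    <-> tr_graph f ys (es k).
  rewrite sat_subst; apply: (sat_bounded (tr_func_bounded tau f)) => i lt /=.
  rewrite /blocks; case: ifP => lt'.
    rewrite /= /prepend ltn_divLR ?dim_gt0 // lt'; exact: eqv_refl.
  have [j Ej jm] : exists2 j, i = far f * m + j & j < m.
    have le : far f * m <= i by rewrite leqNgt lt'.
    by exists (i - far f * m); rewrite ?subnKC // ltn_subLR // addnC -mulSn.
  rewrite /= Ej addnAC -mulnDl !divnMDl ?dim_gt0 // !modnMDl (divn_small jm) !addn0.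
  rewrite prepend_add -[X in prepend _ _ _ X]addn0 prepend_add.
  exact: eqv_refl.
split=> [[ys /sat_And[/sat_bigAnd h /G g]]|[ys h g]]; exists ys => //.
  move=> i; have /sat_And[/sat_dom_at] := h i; rewrite prepend_lt // => di.
  by move/IH; rewrite E prepend_lt.
apply/sat_And; split; last exact/G.
apply/sat_bigAnd => i; have [di hi] := h i; apply/sat_And; split.
  by apply/sat_dom_at; rewrite prepend_lt.
by apply/IH; rewrite E prepend_lt.
Qed.

Lemma sat_tr_Eq es s t :
  sat (blocks m es) (tr tau (Eq s t)) <->
  exists v w, [/\ in_dom v, in_dom w, tm_value es s v, tm_value es t w & tr_eqv v w].
Proof.
rewrite [tr _ _]/= sat_exs_blocks.
have E ys : (fun i => prepend 2 ys es (2 + i)) = es.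
  by apply: functional_extensionality => i; rewrite prepend_add.
have Q ys : sat (blocks m (prepend 2 ys es)) (tr_eq tau) <-> tr_eqv (ys 0) (ys 1).
  apply: sat_blocks (tr_eq_bounded tau) _ => -[|[|]] // j _ _; exact: eqv_refl.
split=> [[ys]|[v [w [dv dw sv tw vw]]]].
  rewrite !sat_And !sat_dom_at !sat_val_tm E Q !prepend_lt //.
  by case=> -[[d0 v0] [d1 v1]] q; exists (ys 0), (ys 1).
exists (scons v (fun _ => w)).
by rewrite !sat_And !sat_dom_at !sat_val_tm E Q !prepend_lt.
Qed.

Lemma sat_tr_Rel es P ts :
  sat (blocks m es) (tr tau (Rel P ts)) <->
  exists2 ys : nat -> nat -> M, forall i : 'I_(par P), in_dom (ys i) /\ tm_value es (ts i) (ys i)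
            & sat (blocks m ys) (tr_pred tau P).
Proof.
rewrite [tr _ _]/= sat_exs_blocks.
have E ys : (fun i => prepend (par P) ys es (par P + i)) = es.
  by apply: functional_extensionality => i; rewrite prepend_add.
have Q ys : sat (blocks m (prepend (par P) ys es)) (tr_pred tau P)
    <-> sat (blocks m ys) (tr_pred tau P).
  apply: sat_blocks (tr_pred_bounded tau P) _ => i j lt _; rewrite prepend_lt //.
  exact: eqv_refl.
split=> [[ys /sat_And[/sat_bigAnd h /Q g]]|[ys h /Q g]]; exists ys => //.
  by move=> i; have := h i; rewrite sat_And sat_dom_at sat_val_tm E prepend_lt.
apply/sat_And; split=> //; apply/sat_bigAnd => i.
by rewrite sat_And sat_dom_at sat_val_tm E prepend_lt.
Qed.

Lemma sat_tr_bigAnd n (F : 'I_n -> form L) v :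
  sat v (tr tau (\big[@And L/Top]_(i < n) F i)) <-> forall i, sat v (tr tau (F i)).
Proof.
rewrite -sat_bigAnd; have -> // : tr tau (\big[@And L/Top]_(i < n) F i)
  = \big[@And L'/Top]_(i < n) tr tau (F i).
exact: (big_morph (tr tau)).
Qed.

Lemma sat_tr_All es A :
  sat (blocks m es) (tr tau (All A)) <->
  forall w, in_dom w -> sat (blocks m (scons w es)) (tr tau A).
Proof.
rewrite [tr _ _]/= sat_alls.
have E w : prepend m w (blocks m es) = blocks m (scons w es).
  have -> : scons w es = prepend 1 (fun _ => w) es.
    by apply: functional_extensionality => -[|i]; rewrite /prepend //= subn1.
  rewrite -prepend_blocks ?dim_gt0 // mul1n; apply: functional_extensionality => v.
  by rewrite /prepend; case: ifP => // lt; rewrite /blocks modn_small.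
have D w : in_dom w <-> sat (blocks m (scons w es)) (tr_dom tau).
  by rewrite -E; apply: in_dom_eqv => j jm; rewrite prepend_lt //; apply: eqv_refl.
split=> h w; first by move/D => dw; have := h w; rewrite E; apply.
by rewrite E => dw; apply: (h w); apply/D.
Qed.

End TranslationSemantics.

(* The structure [K] is the structure defined in [M] by the translation, the
   tuple [r k] being a name of the element [k]. *)
Record realizes (L L' : signature) (tau : translation L L') (M : model L')
    (K : model L) (r : K -> nat -> M) : Prop := Realizes {
  realizes_dom_eq : forall v : nat -> M,
    in_dom tau v <-> exists k, forall j, j < dim tau -> v j = r k j;
  realizes_eq : forall e : nat -> K,
    sat (blocks (dim tau) (fun i => r (e i))) (tr_eq tau) <-> eqv (e 0) (e 1);
  realizes_pred : forall P (e : nat -> K),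
    sat (blocks (dim tau) (fun i => r (e i))) (tr_pred tau P)
    <-> @pint L K P (fun i => e i);
  realizes_func : forall f (e : nat -> K),
    sat (blocks (dim tau) (fun i => r (e i))) (tr_func tau f)
    -> eqv (@fint L K f (fun i => e i)) (e (far f));
  realizes_func_total : forall f (e : nat -> K),
    exists k, tr_graph tau f (fun i => r (e i)) (r k) }.

(** * Truth of a translation is truth in the realized structure *)

Section Realization.
Variables (L L' : signature) (tau : translation L L') (M : model L').
Variables (K : model L) (r : K -> nat -> M).
Hypothesis rz : realizes tau r.
Local Notation m := (dim tau).

Lemma realizes_in_dom k : in_dom tau (r k).
Proof. by apply/(realizes_dom_eq rz); exists k. Qed.

Lemma realizes_dom v :
  in_dom tau v <-> exists k, forall j, j < m -> eqv (v j) (r k j).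
Proof.
split=> [/(realizes_dom_eq rz)[k vk]|[k vk]].
  by exists k => j jm; rewrite vk //; apply: eqv_refl.
by apply/(in_dom_eqv vk)/realizes_in_dom.
Qed.

Lemma realizes_tr_eqv k l : tr_eqv tau (r k) (r l) <-> eqv k l.
Proof.
rewrite -(realizes_eq rz (scons k (fun _ => l))).
by apply: sat_blocks (tr_eq_bounded tau) _ => -[|i] j _ _; apply: eqv_refl.
Qed.

Lemma realizes_name_eqv k l :
  (forall j, j < m -> eqv (r k j) (r l j)) -> eqv k l.
Proof.
move=> kl; apply/realizes_tr_eqv/(tr_eqv_eqv kl (fun j _ => eqv_refl (r l j))).
by apply/realizes_tr_eqv/eqv_refl.
Qed.

Lemma tr_graph_fint f (e : nat -> K) k :
  tr_graph tau f (fun i => r (e i)) (r k) -> eqv (@fint L K f (fun i => e i)) k.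
Proof.
move=> g; have := @realizes_func _ _ _ _ _ _ rz f (prepend (far f) e (fun _ => k)).
rewrite -[X in eqv _ (prepend _ _ _ X)]addn0 prepend_add.
have -> : (fun i : 'I_(far f) => prepend (far f) e (fun _ => k) i) = fun i => e i.
  by apply: functional_extensionality => i; rewrite prepend_lt.
apply; move: g; apply: iffLR; apply: sat_blocks (tr_func_bounded tau f) _ => i j _ _.
by rewrite /prepend; case: ifP => _; apply: eqv_refl.
Qed.

(** The witnesses for the arguments lie in the domain, hence are names of elements up to [eqv];
    induction applies to these elements. *)
Lemma tm_value_eval (e : nat -> K) t w k : tm_value tau (fun i => r (e i)) t w ->
  (forall j, j < m -> eqv (w j) (r k j)) -> eqv (eval e t) k.
Proof.
elim: t w k => [x|f ts IH] w k /=.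
  move=> xw wk; apply: realizes_name_eqv => j jm.
  exact: eqv_trans (xw j jm) (wk j jm).
case=> ys h g wk.
have [|ks hks] := @choice_ord _ (far f)
    (fun i x => forall j, j < m -> eqv (ys i j) (r x j)) k.
  by move=> i; apply/realizes_dom; case: (h i).
have /tr_graph_fint : tr_graph tau f (fun i => r (ks i)) (r k).
  by move: g; apply: iffLR; apply: tr_graph_eqv => // i; apply: hks.
apply: eqv_trans; apply: fint_eqv => i.
by apply: (IH i (ys i)); [case: (h i) | apply: hks].
Qed.

Lemma tm_value_total (e : nat -> K) t :
  exists k, tm_value tau (fun i => r (e i)) t (r k).
Proof.
elim: t => [x|f ts IH]; first by exists (e x) => j _; apply: eqv_refl.
have [ks hks] := choice_ord (e 0) IH.
have [k hk] := @realizes_func_total _ _ _ _ _ _ rz f ks.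
exists k; exists (fun i => r (ks i)) => // i; split=> //; exact: realizes_in_dom.
Qed.

(** Unravelled atoms are existential statements, so one direction uses that every value found names
    the right element and the other that some value exists. *)
Theorem sat_tr A (e : nat -> K) :
  sat (blocks m (fun i => r (e i))) (tr tau A) <-> sat e A.
Proof.
elim: A e => [//|s t|P ts|A IHA B IHB|A IHA] e.
- rewrite sat_tr_Eq; split=> [[v [w [dv dw sv tw vw]]]|st].
    have [k vk] := proj1 (realizes_dom v) dv.
    have [l wl] := proj1 (realizes_dom w) dw.
    apply: eqv_trans (tm_value_eval sv vk) _.
    apply: eqv_trans (eqv_sym (tm_value_eval tw wl)).
    by apply/realizes_tr_eqv/(tr_eqv_eqv vk wl).
  have [k hk] := tm_value_total e s; have [l hl] := tm_value_total e t.
  exists (r k), (r l); split=> //; try exact: realizes_in_dom.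
  apply/realizes_tr_eqv.
  apply: eqv_trans (eqv_sym (tm_value_eval hk (fun j _ => eqv_refl _))) _.
  exact: eqv_trans st (tm_value_eval hl (fun j _ => eqv_refl _)).
- rewrite sat_tr_Rel; split=> [[ys h p]|p].
    have [|ks hks] := @choice_ord _ (par P)
        (fun i x => forall j, j < m -> eqv (ys i j) (r x j)) (e 0).
      by move=> i; apply/realizes_dom; case: (h i).
    have /(realizes_pred rz) : sat (blocks m (fun i => r (ks i))) (tr_pred tau P).
      by move: p; apply: iffLR; apply: sat_blocks (tr_pred_bounded tau P) _ => i j lt;
        apply: (hks (Ordinal lt)).
    apply: pint_eqv => i; apply: eqv_sym.
    by apply: (@tm_value_eval _ _ (ys i)); [case: (h i) | apply: hks].
  have [ks hks] := choice_ord (e 0) (fun i => tm_value_total e (ts i)).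
  exists (fun i => r (ks i)) => [i|]; first by split; [apply: realizes_in_dom|].
  apply/(realizes_pred rz); move: p; apply: pint_eqv => i.
  by apply: tm_value_eval (hks i) _ => j _; apply: eqv_refl.
- by rewrite /= IHA IHB.
- rewrite sat_tr_All; split=> [h k|h w /realizes_dom[k wk]].
    apply/IHA; move: (h _ (realizes_in_dom k)); congr sat; congr blocks.
    by apply: functional_extensionality => -[].
  have /IHA := h k; apply: iffLR; apply: sat_eqv => v.
  rewrite /blocks; case: (v %/ m) => [|i] /=; last exact: eqv_refl.
  by apply: eqv_sym; apply: wk; rewrite ltn_mod dim_gt0.
Qed.

Lemma sat_tr_closed A (x : M) (k : K) : bounded 0 A ->
  sat (fun _ => x) (tr tau A) <-> sat (fun _ => k) A.
Proof.
move=> bA; rewrite -sat_tr; apply: sat_closed.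
by rewrite -[0](mul0n m); apply: bounded_tr.
Qed.

End Realization.

(** * The structure defined by an interpretation *)

Section InternalModel.
Variables (L L' : signature) (tau : translation L L') (M : model L') (x0 : M).
Local Notation m := (dim tau).
Hypothesis tau_valid : forall A : sentence L,
  (forall (K : model L) (e : nat -> K), sat e A) -> forall e : nat -> M, sat e (tr tau A).

Lemma sat_tr_alls n A (e : nat -> M) (es : nat -> nat -> M) : sat e (tr tau (alls n A)) ->
  (forall i, i < n -> in_dom tau (es i)) ->
  sat (prepend (n * m) (blocks m es) e) (tr tau A).
Proof.
elim: n e => [|n IH] e.
  rewrite mul0n => h _; move: h; congr sat.
  by apply: functional_extensionality => i; rewrite /prepend subn0.
have -> : tr tau (alls n.+1 A) = alls m (Imp (tr_dom tau) (tr tau (alls n A))) by [].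
move/sat_alls/(_ (es n)) => /= h des; rewrite -prepend_blocks_succ.
apply: IH => [|i lt]; last by apply: des; apply: leqW.
apply: h; move: (des n (leqnn _)); apply: iffLR; apply: in_dom_eqv => j jm.
by rewrite prepend_lt //; apply: eqv_refl.
Qed.

(** The hypothesis [tau_valid] is about sentences; an open valid formula is closed universally and
    then instantiated at tuples of the domain. *)
Lemma tau_valid_open A (es : nat -> nat -> M) : (forall (K : model L) (e : nat -> K), sat e A) ->
  (forall i, in_dom tau (es i)) -> sat (blocks m es) (tr tau A).
Proof.
move=> val des; have bA := bounded_bound (leqnn (bound A)).
have cl : bounded 0 (alls (bound A) A) by rewrite bounded_alls addn0.
have := @tau_valid (Sentence cl) _ (blocks m es).
move=> h; have {h} := h (fun K e => proj2 (sat_alls _ _ _) (fun w => val K _)).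
move=> h; have := sat_tr_alls (es := es) h (fun i _ => des i).
apply: iffLR; apply: (sat_bounded (bounded_tr tau bA)) => i lt.
by rewrite prepend_lt //; apply: eqv_refl.
Qed.

(** Read off from the translation of [exists x, x = x], which is valid because every environment
    supplies an element. *)
Lemma in_dom_inhabited : exists w : nat -> M, in_dom tau w.
Proof.
apply: NNPP => no.
have cl : bounded 0 (Ex (Eq (Var 0) (Var 0)) : form L) by [].
have := @tau_valid (Sentence cl) _ (fun _ => x0).
apply=> [K e|]; first by apply/sat_Ex; exists (e 0); apply: eqv_refl.
apply/sat_alls => w /= dw; case: no; exists (prepend m w (fun _ => x0)).
exact: dw.
Qed.

Let S := {w : nat -> M | in_dom tau w}.
Implicit Types (es : nat -> S).

Lemma sat_tr_Eq_Var es a b :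
  sat (blocks m (fun i => sval (es i))) (tr tau (Eq (Var a) (Var b)))
  <-> tr_eqv tau (sval (es a)) (sval (es b)).
Proof.
rewrite sat_tr_Eq; split=> [[v [w [_ _ /= sv tw]]]|ab].
  by apply: iffRL; apply: tr_eqv_eqv.
exists (sval (es a)), (sval (es b)).
by split=> //; try exact: svalP; move=> j _; apply: eqv_refl.
Qed.

Lemma sat_tr_Rel_Var es P (g : nat -> nat) :
  sat (blocks m (fun i => sval (es i))) (tr tau (Rel P (fun i => Var (g i))))
  <-> sat (blocks m (fun i => sval (es (g i)))) (tr_pred tau P).
Proof.
rewrite sat_tr_Rel; split=> [[ys h]|h].
  apply: iffRL; apply: sat_blocks (tr_pred_bounded tau P) _ => i j lt jm.
  by case: (h (Ordinal lt)) => _; apply.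
exists (fun i => sval (es (g i))) => // i.
by split; [exact: svalP | move=> j _; apply: eqv_refl].
Qed.

(** Each law of the translated equality, here and in the next lemmas, is the translation of a valid
    formula of equality logic. *)
Lemma tr_eqv_refl (k : S) : tr_eqv tau (sval k) (sval k).
Proof.
apply/(sat_tr_Eq_Var (fun _ => k) 0 0); apply: tau_valid_open => [K e|i].
  exact: eqv_refl.
exact: svalP.
Qed.

Lemma tr_eqv_sym (k l : S) :
  tr_eqv tau (sval k) (sval l) -> tr_eqv tau (sval l) (sval k).
Proof.
pose es := scons k (fun _ => l).
move/(sat_tr_Eq_Var es 0 1) => kl; apply/(sat_tr_Eq_Var es 1 0).
have := @tau_valid_open (Imp (Eq (Var 0) (Var 1)) (Eq (Var 1) (Var 0)))
  (fun i => sval (es i)).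
apply=> [K e|i|//]; [exact: eqv_sym | exact: svalP].
Qed.

Lemma tr_eqv_trans (k l p : S) : tr_eqv tau (sval k) (sval l) ->
  tr_eqv tau (sval l) (sval p) -> tr_eqv tau (sval k) (sval p).
Proof.
pose es := scons k (scons l (fun _ => p)).
move=> /(sat_tr_Eq_Var es 0 1) kl /(sat_tr_Eq_Var es 1 2) lp.
apply/(sat_tr_Eq_Var es 0 2).
have := @tau_valid_open
  (Imp (Eq (Var 0) (Var 1)) (Imp (Eq (Var 1) (Var 2)) (Eq (Var 0) (Var 2))))
  (fun i => sval (es i)).
apply=> [K e|i|//|//]; [exact: eqv_trans | exact: svalP].
Qed.

Lemma tr_pred_tr_eqv P es es' :
  (forall i : 'I_(par P), tr_eqv tau (sval (es i)) (sval (es' i))) ->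
  sat (blocks m (fun i => sval (es i))) (tr_pred tau P) ->
  sat (blocks m (fun i => sval (es' i))) (tr_pred tau P).
Proof.
(* Both argument lists sit side by side in one environment, so that a single valid formula can
   compare them. *)
move=> ee; pose n := par P; pose fs := prepend n es es'.
have Ef i : fs (n + i) = es' i by rewrite /fs prepend_add.
have -> : es' = fun i => fs (n + i).
  by apply: functional_extensionality.
have -> : sat (blocks m (fun i => sval (es i))) (tr_pred tau P)
      <-> sat (blocks m (fun i => sval (fs i))) (tr_pred tau P).
  apply: sat_blocks (tr_pred_bounded tau P) _ => i j lt _.
  by rewrite /fs prepend_lt //; apply: eqv_refl.
move/(sat_tr_Rel_Var fs P id) => h; apply/(sat_tr_Rel_Var fs P (addn n)).
have := @tau_valid_open
  (Imp (\big[@And L/Top]_(i < n) Eq (Var i) (Var (n + i)))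
  (Imp (Rel P (fun i => Var i)) (Rel P (fun i => Var (n + i)))))
  (fun i => sval (fs i)).
apply=> [K e|i||//]; [|exact: svalP|].
  by move/sat_bigAnd => E; apply: pint_eqv.
apply/sat_tr_bigAnd => i; apply/sat_tr_Eq_Var.
by rewrite Ef /fs prepend_lt.
Qed.

(** Even the trivial equation f(x) = f(x), once unravelled, asserts that a value exists. *)
Lemma tr_graph_total f es :
  exists k : S, tr_graph tau f (fun i => sval (es i)) (sval k).
Proof.
have := @tau_valid_open (Eq (App f (fun i => Var i)) (App f (fun i => Var i)))
  (fun i => sval (es i)).
case/(_ _ _)/sat_tr_Eq => [K e|i|v [w [dv _ [ys h g] _ _]]]; first exact: eqv_refl.
  exact: svalP.
exists (exist _ v dv); move: g; apply: iffRL; apply: tr_graph_eqv => [i j jm|j jm].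
  by case: (h i) => _; apply.
exact: eqv_refl.
Qed.

Lemma sat_tr_App_Var f es (g : nat -> nat) b :
  tr_graph tau f (fun i => sval (es (g i))) (sval (es b)) ->
  sat (blocks m (fun i => sval (es i))) (tr tau (Eq (App f (fun i => Var (g i))) (Var b))).
Proof.
move=> gr; apply/sat_tr_Eq; exists (sval (es b)), (sval (es b)).
split=> //; try exact: svalP; last exact: tr_eqv_refl.
  exists (fun i => sval (es (g i))) => // i.
  by split; [exact: svalP | move=> j _; apply: eqv_refl].
by move=> j _; apply: eqv_refl.
Qed.

(** Uniqueness of values and congruence at once, from the valid formula x = y -> f(x) = a -> f(y) =
    b -> a = b; [fs] lists x, y, a and b in this order. *)
Lemma tr_graph_tr_eqv f es es' (k k' : S) :
  (forall i : 'I_(far f), tr_eqv tau (sval (es i)) (sval (es' i))) ->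
  tr_graph tau f (fun i => sval (es i)) (sval k) ->
  tr_graph tau f (fun i => sval (es' i)) (sval k') ->
  tr_eqv tau (sval k) (sval k').
Proof.
move=> ee gk gk'; pose n := far f.
pose fs := prepend n es (prepend n es' (scons k (fun _ => k'))).
have F0 (i : 'I_n) : fs i = es i by rewrite /fs prepend_lt.
have F1 (i : 'I_n) : fs (n + i) = es' i by rewrite /fs prepend_add prepend_lt.
have F2 : fs (n + (n + 0)) = k by rewrite /fs !prepend_add.
have F3 : fs (n + (n + 1)) = k' by rewrite /fs !prepend_add.
rewrite -F2 -F3; apply/sat_tr_Eq_Var.
have := @tau_valid_open
  (Imp (\big[@And L/Top]_(i < n) Eq (Var i) (Var (n + i)))
  (Imp (Eq (App f (fun i => Var i)) (Var (n + (n + 0))))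
  (Imp (Eq (App f (fun i => Var (n + i))) (Var (n + (n + 1))))
       (Eq (Var (n + (n + 0))) (Var (n + (n + 1)))))))
  (fun i => sval (fs i)).
apply=> [K e|i|||]; last 1 first.
- apply: (sat_tr_App_Var (g := addn n)); rewrite F3; move: gk'; apply: iffLR.
  by apply: tr_graph_eqv => [i|] j _; rewrite ?F1; apply: eqv_refl.
- move/sat_bigAnd => /= E Ek Ek'.
  apply: eqv_trans (eqv_sym Ek) (eqv_trans _ Ek').
  exact: fint_eqv.
- exact: svalP.
- apply/sat_tr_bigAnd => i; apply/sat_tr_Eq_Var; rewrite F0 F1; exact: ee.
- apply: (sat_tr_App_Var (g := id)); rewrite F2; move: gk; apply: iffLR.
  by apply: tr_graph_eqv => [i|] j _; rewrite ?F0; apply: eqv_refl.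
Qed.

(** The elements are the tuples of the domain, with the translated equality as congruence. Function
    values are picked by description; the choice is harmless by [tr_graph_tr_eqv]. *)
Theorem internal_model : exists (K : model L) (r : K -> nat -> M), realizes tau r.
Proof.
have [w0 dw0] := in_dom_inhabited; pose k0 : S := exist _ w0 dw0.
pose fam n (u : 'I_n -> S) i := extend_fam k0 u i.
have famE n (u : 'I_n -> S) (i : 'I_n) : fam n u i = u i by apply: extend_famE.
pose fi f (u : 'I_(far f) -> S) : S :=
  sval (constructive_indefinite_description _ (tr_graph_total f (fam _ u))).
have fiP f u : tr_graph tau f (fun i => sval (fam _ u i)) (sval (fi f u)).
  by rewrite /fi; case: (constructive_indefinite_description _ _).
pose pi P (u : 'I_(par P) -> S) : Prop :=
  sat (blocks m (fun i => sval (fam _ u i))) (tr_pred tau P).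
have fi_eqv f u v : (forall i, tr_eqv tau (sval (u i)) (sval (v i))) ->
    tr_eqv tau (sval (fi f u)) (sval (fi f v)).
  move=> uv; apply: tr_graph_tr_eqv (fiP f u) (fiP f v) => i.
  by rewrite !famE.
have pi_eqv P u v : (forall i, tr_eqv tau (sval (u i)) (sval (v i))) -> pi P u -> pi P v.
  by move=> uv; apply: tr_pred_tr_eqv => i; rewrite !famE.
exists (@Model L S (fun k l => tr_eqv tau (sval k) (sval l)) fi pi
  tr_eqv_refl tr_eqv_sym tr_eqv_trans fi_eqv pi_eqv).
exists (@sval _ _); split=> /=.
- move=> v; split=> [dv|[k vk]]; first by exists (exist _ v dv).
  apply/(in_dom_eqv (w := sval k)); last exact: svalP.
  by move=> j jm; rewrite vk //; apply: eqv_refl.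
- move=> e; apply: sat_blocks (tr_eq_bounded tau) _.
  by case=> [|[|]] // j _ _; apply: eqv_refl.
- move=> P e; apply: sat_blocks (tr_pred_bounded tau P) _ => i j lt _.
  by rewrite (famE _ _ (Ordinal lt)); apply: eqv_refl.
- move=> f e g; apply: (@tr_graph_tr_eqv f _ e _ _ _ (fiP f _)) => [i|].
    by rewrite famE; apply: tr_eqv_refl.
  move: g; apply: iffLR; apply: sat_blocks (tr_func_bounded tau f) _ => i j.
  rewrite ltnS leq_eqVlt /prepend => /orP[/eqP ->|->] _; last exact: eqv_refl.
  by rewrite ltnn; apply: eqv_refl.
- by move=> f e; apply: tr_graph_total.
Qed.

End InternalModel.

(** By completeness [V] proves all valid sentences and its own axioms, so their translations hold in
    [M]. The former build the internal structure, the latter make it a model of [V]. *)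
Theorem interprets_model (L L' : signature) (tau : translation L L') V U
    (M : model L') (x0 : M) : interprets tau V U -> models M U ->
  exists (K : model L) (r : K -> nat -> M), [/\ realizes tau r, inhabited K & models K V].
Proof.
move=> VU MU.
have tau_sat (A : sentence L) : proves V A -> forall e : nat -> M, sat e (tr tau A).
  by move/VU; apply: proves_sound.
have tau_val (A : sentence L) : (forall (K : model L) (e : nat -> K), sat e A) ->
    forall e : nat -> M, sat e (tr tau A).
  by move=> vA; apply: tau_sat; apply: completeness => K e _; apply: vA.
have [K [r rz]] := internal_model x0 tau_val.
exists K, r; split=> // [|A VA e].
  have [w /(realizes_dom rz)[k _]] := in_dom_inhabited x0 tau_val.
  exact: inhabits k.
rewrite -(sat_tr rz); apply: tau_sat.
by apply: completeness => K' e' /(_ _ VA).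
Qed.

(** The converse passage, again by completeness. The point [x0] costs nothing, since truth of a
    formula is evaluated at some environment. *)
Lemma realizes_interprets (L L' : signature) (tau : translation L L') V U :
  (forall (M : model L') (x0 : M), models M U ->
    exists (K : model L) (r : K -> nat -> M),
      [/\ realizes tau r, inhabited K & models K V]) ->
  interprets tau V U.
Proof.
move=> h A VA; apply: completeness => M e MU.
have [K [r [rz [k] KV]]] := h M (e 0) MU.
have bA := sentence_closed A; have trA : bounded 0 (tr tau A).
  by rewrite -[0](mul0n (dim tau)); apply: bounded_tr.
apply/(sat_closed e (fun _ => e 0) trA)/(sat_tr_closed rz (e 0) k bA).
exact: proves_sound KV VA _.
Qed.

(** * Composition of interpretations *)

Section Composition.
Variables (L1 L2 L3 : signature) (F : translation L1 L2) (tau : translation L2 L3).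
Let m := dim tau.
Let d := dim F.

Lemma comp_dim_gt0 : 0 < d * m.
Proof. by rewrite muln_gt0 !dim_gt0. Qed.

Definition comp_dom : form L3 :=
  And (\big[@And L3/Top]_(i < d) dom_at tau i) (tr tau (tr_dom F)).

Lemma comp_dom_bounded : bounded (d * m) comp_dom.
Proof.
rewrite bounded_And bounded_tr ?tr_dom_bounded // andbT.
by apply: bounded_bigAnd => i; apply: bounded_dom_at.
Qed.

Lemma bounded_tr_mul n A : bounded (n * d) A -> bounded (n * (d * m)) (tr tau A).
Proof. by rewrite mulnA; apply: bounded_tr. Qed.

Definition comp_translation : translation L1 L3 :=
  @Translation L1 L3 (d * m) comp_dim_gt0 comp_dom (tr tau (tr_eq F))
    (fun P => tr tau (tr_pred F P)) (fun f => tr tau (tr_func F f))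
    comp_dom_bounded (bounded_tr_mul (tr_eq_bounded F))
    (fun P => bounded_tr_mul (tr_pred_bounded F P))
    (fun f => bounded_tr_mul (tr_func_bounded F f)).

Lemma blocks_blocks (X : Type) (es : nat -> nat -> nat -> X) :
  blocks (d * m) (fun i => blocks m (es i)) = blocks m (blocks d es).
Proof.
apply: functional_extensionality => v; rewrite /blocks.
congr (es _ _ _); first by rewrite mulnC divnMA.
  by rewrite modn_divl.
by rewrite modn_dvdm // dvdn_mull.
Qed.

(** Composition is verified on structures: a name of a name is flattened into one tuple. The
    formulas [tr comp_translation A] and [tr tau (tr F A)] are never compared. *)
Lemma realizes_comp (M : model L3) (K : model L2) (r : K -> nat -> M)
    (K' : model L1) (r' : K' -> nat -> K) :
  realizes tau r -> realizes F r' ->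
  realizes comp_translation (fun k => blocks m (fun i => r (r' k i))).
Proof.
move=> rz rz'.
have satE A (e : nat -> K') :
    sat (blocks (d * m) (fun i => blocks m (fun j => r (r' (e i) j)))) (tr tau A)
    <-> sat (blocks d (fun i => r' (e i))) A.
  rewrite (blocks_blocks (fun i j => r (r' (e i) j))).
  exact: (sat_tr rz A (blocks d (fun i => r' (e i)))).
split=> /=.
- move=> v; rewrite /in_dom sat_And sat_bigAnd.
  have dm0 := comp_dim_gt0.
  pose vs i j := v (i * m + j); have Ev : v = blocks m vs by rewrite blocks_split.
  rewrite {1 2}Ev; split=> [[h dv]|[k vk]].
    have [k0 _] : exists k : K, True.
      have /sat_dom_at/(realizes_dom rz)[k _] := h (Ordinal (dim_gt0 F)).
      by exists k.
    have [|ks hks] := @choice_ord _ d (fun i x => forall j, j < m -> vs i j = r x j) k0.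
      move=> i; apply/(realizes_dom_eq rz).
      exact: (proj1 (sat_dom_at _ _ _) (h i)).
    have /(realizes_dom_eq rz')[k kk] : in_dom F ks.
      apply/(sat_tr rz); move: dv; apply: iffLR.
      apply: sat_blocks (bounded_tr tau (tr_dom_bounded F)) _ => i j lt jm.
      by rewrite (hks (Ordinal lt)) //; apply: eqv_refl.
    exists k => u lt; rewrite Ev /blocks.
    have lt' : u %/ m < d by rewrite ltn_divLR ?dim_gt0.
    by rewrite (hks (Ordinal lt')) ?kk // ltn_mod dim_gt0.
  have Evs i j : i < d -> j < m -> vs i j = r (r' k i) j.
    by move=> id jm; rewrite /vs vk ?block_lt // blocks_at.
  split=> [i|].
    apply/sat_dom_at/(realizes_dom_eq rz); exists (r' k i) => j jm.
    exact: Evs.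
  have := realizes_in_dom rz' k; move/(sat_tr rz); apply: iffLR.
  apply: sat_blocks (bounded_tr tau (tr_dom_bounded F)) _ => i j lt jm.
  by rewrite Evs //; apply: eqv_refl.
- by move=> e; rewrite satE (realizes_eq rz').
- by move=> P e; rewrite satE (realizes_pred rz').
- by move=> f e /satE/(realizes_func rz').
- move=> f e; have [k hk] := realizes_func_total rz' f e; exists k.
  have -> : tr_graph comp_translation f (fun i => blocks m (fun j => r (r' (e i) j)))
      (blocks m (fun j => r (r' k j)))
    = sat (blocks (d * m) (fun i =>
        blocks m (fun j => r (r' (prepend (far f) e (fun _ => k) i) j))))
      (tr tau (tr_func F f)).
    congr sat; congr blocks; apply: functional_extensionality => i.
    by rewrite /prepend; case: ifP.
  apply/satE; move: hk; congr sat; congr blocks; apply: functional_extensionality => i.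
  by rewrite /prepend; case: ifP.
Qed.

End Composition.

Theorem interpretable_trans (L1 L2 L3 : signature)
    (W : theory L1) (V : theory L2) (U : theory L3) :
  interpretable W V -> interpretable V U -> interpretable W U.
Proof.
move=> [F FW] [tau tV]; exists (comp_translation F tau).
apply: realizes_interprets => M x0 MU.
have [K [r [rz [k] KV]]] := interprets_model x0 tV MU.
have [K' [r' [rz' iK' KW]]] := interprets_model k FW KV.
by exists K', (fun k => blocks (dim tau) (fun i => r (r' k i))); split=> //; apply: realizes_comp.
Qed.

(** * Representability of recursive functions in R *)

Definition models_R (Q : model arith) : Prop :=
  forall A, R_axiom A -> forall e : nat -> Q, sat e A.

(** * Numerals in models of R *)

Section ModelsOfR.
Variable Q : model arith.

Definition qzero : Q := @fint arith Q AZero (fun i : 'I_0 => False_rect Q (notF (ltn_ord i))).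
Definition qsucc (x : Q) : Q := @fint arith Q ASucc (fun _ => x).
Definition qadd (x y : Q) : Q := @fint arith Q AAdd (fun i : 'I_2 => if i == ord0 then x else y).
Definition qmul (x y : Q) : Q := @fint arith Q AMul (fun i : 'I_2 => if i == ord0 then x else y).
Definition qnum (n : nat) : Q := iter n qsucc qzero.
Definition qle (x y : Q) : Prop := exists z, eqv (qadd z x) y.

Lemma eval_Zero (e : nat -> Q) : eval e Zero = qzero.
Proof.
by rewrite /= /qzero; congr fint; apply: functional_extensionality => -[].
Qed.

Lemma eval_Succ (e : nat -> Q) t : eval e (Succ t) = qsucc (eval e t).
Proof. by []. Qed.

Lemma eval_Add (e : nat -> Q) s t : eval e (Add s t) = qadd (eval e s) (eval e t).
Proof.
rewrite /= /qadd; congr fint; apply: functional_extensionality => i.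
by case: ifP.
Qed.

Lemma eval_Mul (e : nat -> Q) s t : eval e (Mul s t) = qmul (eval e s) (eval e t).
Proof.
rewrite /= /qmul; congr fint; apply: functional_extensionality => i.
by case: ifP.
Qed.

Lemma eval_numeral (e : nat -> Q) n : eval e (numeral n) = qnum n.
Proof. by elim: n => [|n IH]; rewrite ?eval_Zero // eval_Succ IH. Qed.

Lemma qsucc_eqv x y : eqv x y -> eqv (qsucc x) (qsucc y).
Proof. by move=> xy; apply: fint_eqv. Qed.

Lemma qadd_eqv x x' y y' : eqv x x' -> eqv y y' -> eqv (qadd x y) (qadd x' y').
Proof. by move=> xx yy; apply: fint_eqv => i; case: ifP. Qed.

Lemma qle_eqv x x' y y' : eqv x x' -> eqv y y' -> qle x y -> qle x' y'.
Proof.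
move=> xx yy [z zx]; exists z; apply: eqv_trans yy; apply: eqv_trans zx.
exact: qadd_eqv (eqv_refl z) (eqv_sym xx).
Qed.

Lemma sat_Eq (e : nat -> Q) s t : sat e (Eq s t) = eqv (eval e s) (eval e t).
Proof. by []. Qed.

Lemma sat_Le (e : nat -> Q) s t : sat e (Le s t) <-> qle (eval e s) (eval e t).
Proof.
rewrite /Le sat_Ex; split=> -[z h]; exists z; move: h;
  by rewrite sat_Eq eval_Add /shift_tm !eval_subst.
Qed.

Lemma sat_is_numeral n (e : nat -> Q) : sat e (is_numeral n) <-> eqv (e 0) (qnum n).
Proof.
elim: n e => [|n IH] e.
  by rewrite [is_numeral _]/= sat_Eq eval_Zero.
rewrite [is_numeral _]/= sat_Ex; split=> [[y /sat_And[/IH yn ye]]|en].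
  exact: eqv_trans (eqv_sym ye) (qsucc_eqv yn).
exists (qnum n); apply/sat_And; split; first by apply/IH; apply: eqv_refl.
exact: eqv_sym.
Qed.

Hypothesis QR : models_R Q.

Lemma qnum_inj n k : eqv (qnum n) (qnum k) <-> n = k.
Proof.
split=> [nk|->]; last exact: eqv_refl.
apply: NNPP => ne; have := QR (R_neq ne) (fun _ => qzero).
by rewrite /= !eval_numeral; apply.
Qed.

Lemma qadd_num n k : eqv (qadd (qnum n) (qnum k)) (qnum (n + k)).
Proof.
have := QR (R_add n k) (fun _ => qzero).
by rewrite sat_Eq eval_Add !eval_numeral.
Qed.

Lemma qmul_num n k : eqv (qmul (qnum n) (qnum k)) (qnum (n * k)).
Proof.
have := QR (R_mul n k) (fun _ => qzero).
by rewrite sat_Eq eval_Mul !eval_numeral.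
Qed.

(** The fact that makes bounded quantifiers absolute: nothing nonstandard lies below a numeral.
    Conversely [n - i] witnesses [i <= n]. *)
Lemma qle_num x n : qle x (qnum n) <-> exists2 i, i <= n & eqv x (qnum i).
Proof.
split=> [xn|[i le xi]].
  have := QR (R_le n) (fun _ => qzero) x.
  move=> h; have /sat_bigOr[i] : sat (scons x (fun _ => qzero))
      (\big[@Or arith/Bot]_(i < n.+1) Eq (Var 0) (numeral i)).
    by apply: h; apply/sat_Le; rewrite eval_numeral.
  by rewrite /= eval_numeral => xi; exists i => //; rewrite -ltnS.
apply: qle_eqv (eqv_sym xi) (eqv_refl _) _.
by exists (qnum (n - i)); rewrite -{2}(subnK le); apply: qadd_num.
Qed.

Lemma qle_total x n : qle x (qnum n) \/ qle (qnum n) x.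
Proof.
have : sat (scons x (fun _ => qzero)) (Or (Le (Var 0) (numeral n)) (Le (numeral n) (Var 0))).
  exact: (QR (R_total n) (fun _ => qzero) x).
by rewrite sat_Or !sat_Le eval_numeral.
Qed.

End ModelsOfR.

(* Only the values of the formula at numerals are prescribed; on other elements
   it is arbitrary. *)
Definition binumerable (P : (nat -> nat) -> Prop) : Prop :=
  exists A : form arith, forall Q, models_R Q -> forall e : nat -> nat,
    sat (fun i => qnum Q (e i)) A <-> P e.

(** Inputs are numerals, but [y] runs over the whole model, so a nonstandard output is excluded. The
    formula is chosen before the model. *)
Definition representable (F : (nat -> nat) -> nat) : Prop :=
  exists A : form arith, forall Q, models_R Q -> forall (e : nat -> nat) y,
    sat (scons y (fun i => qnum Q (e i))) A <-> eqv y (qnum Q (F e)).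

Lemma qnum_scons (Q : model arith) n (e : nat -> nat) :
  (fun i => qnum Q (scons n e i)) = scons (qnum Q n) (fun i => qnum Q (e i)).
Proof. by apply: functional_extensionality => -[]. Qed.

(** * Closure properties of binumerable relations and representable functions *)

Section Representability.
Implicit Types (P : (nat -> nat) -> Prop) (F G : (nat -> nat) -> nat).

Lemma binumerable_iff P P' : (forall e, P e <-> P' e) -> binumerable P -> binumerable P'.
Proof. by move=> PP [A hA]; exists A => Q QR e; rewrite hA. Qed.

Lemma representable_eq F G : F =1 G -> representable F -> representable G.
Proof. by move=> FG [A hA]; exists A => Q QR e y; rewrite hA // FG. Qed.

Lemma binumerable_imp P P' : binumerable P -> binumerable P' ->
  binumerable (fun e => P e -> P' e).
Proof. by move=> [A hA] [B hB]; exists (Imp A B) => Q QR e /=; rewrite hA ?hB. Qed.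

Lemma binumerable_not P : binumerable P -> binumerable (fun e => ~ P e).
Proof. by move=> [A hA]; exists (Neg A) => Q QR e; rewrite /= hA. Qed.

Lemma binumerable_and P P' : binumerable P -> binumerable P' ->
  binumerable (fun e => P e /\ P' e).
Proof. by move=> [A hA] [B hB]; exists (And A B) => Q QR e; rewrite sat_And hA ?hB. Qed.

(** Only the first [bound A] inputs matter. They are quantified existentially, and representability
    pins each witness to a numeral, where [A] is known to be correct. *)
Lemma binumerable_comp P (s : (nat -> nat) -> nat -> nat) : binumerable P ->
  (forall i, representable (fun e => s e i)) -> binumerable (fun e => P (s e)).
Proof.
move=> [A hA] hs; pose n := bound A.
pose B i := sval (constructive_indefinite_description _ (hs i)).
have hB i Q (QR : models_R Q) e y :
    sat (scons y (fun i => qnum Q (e i))) (B i) <-> eqv y (qnum Q (s e i)).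
  by rewrite /B; case: (constructive_indefinite_description _ _) => /= C; apply.
(* In [B i] index 0 is the output, which becomes the quantified variable [i]; the parameters move
   past the [n] quantifiers. *)
pose rho i j := Var (if j is j'.+1 then n + j' else i) : term arith.
exists (exs n (And (\big[@And arith/Top]_(i < n) subst (rho i) (B i)) A)) => Q QR e.
have E w (i : 'I_n) : sat (prepend n w (fun i => qnum Q (e i))) (subst (rho i) (B i))
    <-> eqv (w i) (qnum Q (s e i)).
  rewrite sat_subst -hB //; apply: sat_eqv => -[|j] /=.
    by rewrite prepend_lt //; apply: eqv_refl.
  by rewrite prepend_add; apply: eqv_refl.
have D (w : nat -> Q) : (forall i : 'I_n, eqv (w i) (qnum Q (s e i))) ->
    sat (prepend n w (fun i => qnum Q (e i))) A <-> P (s e).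
  move=> ws; rewrite -(hA Q QR); apply: (sat_bounded (bounded_bound (leqnn _))) => i lt.
  by rewrite prepend_lt //; apply: (ws (Ordinal lt)).
rewrite sat_exs; split=> [[w /sat_And[/sat_bigAnd ws]]|Ps].
  exact: iffLR (D w (fun i => iffLR (E w i) (ws i))).
have ws (i : 'I_n) : eqv (qnum Q (s e i)) (qnum Q (s e i)) by exact: eqv_refl.
exists (fun i => qnum Q (s e i)); apply/sat_And; split; last exact: iffRL (D _ ws) Ps.
by apply/sat_bigAnd => i; apply/E; apply: ws.
Qed.

(* The second conjunct forces minimality among all elements [u <= y], so that
   a nonstandard [y], lying above the true minimum, is excluded. *)
Lemma representable_min P F : binumerable P -> (forall e, P (scons (F e) e)) ->
  (forall e y, P (scons y e) -> F e <= y) -> representable F.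
Proof.
move=> [A hA] PF minF.
pose A' := subst (scons (Var 0) (fun i => Var i.+2)) A.
exists (And A (All (Imp (And (Le (Var 0) (Var 1)) A') (Eq (Var 0) (Var 1))))).
move=> Q QR e y; set en := fun i => qnum Q (e i).
have hA' u : sat (scons u (scons y en)) A' <-> sat (scons u en) A.
  by rewrite sat_subst; apply: sat_eqv => -[|i]; apply: eqv_refl.
have hn n : sat (scons (qnum Q n) en) A <-> P (scons n e).
  by rewrite -(hA Q QR) qnum_scons.
have hy z n : eqv z (qnum Q n) -> sat (scons z en) A <-> P (scons n e).
  by move=> zn; rewrite -hn; apply: sat_eqv => -[|i] //; apply: eqv_refl.
rewrite sat_And; split=> [[Py min]|yF].
  have minF' u : qle u y -> sat (scons u en) A -> eqv u y.
    have : sat (scons u (scons y en)) (And (Le (Var 0) (Var 1)) A') -> eqv u y := min u.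
    by rewrite sat_And sat_Le hA' => h uy Au; apply: h.
  case: (qle_total QR y (F e)) => [/(qle_num QR)[i le yi]|le].
    have /minF le' : P (scons i e) by apply/(hy y).
    by rewrite (_ : F e = i) //; apply/eqP; rewrite eqn_leq le le'.
  by apply: eqv_sym; apply: minF' => //; apply/hn.
split; first by apply/(hy _ _ yF).
move=> u; suff : sat (scons u (scons y en)) (And (Le (Var 0) (Var 1)) A') -> eqv u y by [].
rewrite sat_And sat_Le hA' => -[/= uy Au].
have /(qle_num QR)[i le ui] := qle_eqv (eqv_refl u) yF uy.
have /minF le' : P (scons i e) by apply/(hy u).
apply: eqv_trans ui (eqv_trans _ (eqv_sym yF)).
by apply/qnum_inj => //; apply/eqP; rewrite eqn_leq le le'.
Qed.

Lemma binumerable_graph F : representable F -> binumerable (fun e => e 0 = F (fun i => e i.+1)).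
Proof.
move=> [A hA]; exists A => Q QR e; rewrite -(qnum_inj QR) -(hA Q QR).
by apply: sat_eqv => -[|i]; apply: eqv_refl.
Qed.

(** A formula correct at numerals is turned into one correct for every [y] by minimization; the
    value is the least, indeed the only, number in the graph. *)
Lemma representable_graph F : binumerable (fun e => e 0 = F (fun i => e i.+1)) -> representable F.
Proof. by move/representable_min; apply=> // e y /= ->. Qed.

Lemma representable_var i : representable (fun e => e i).
Proof. by exists (Eq (Var 0) (Var i.+1)) => Q QR e y. Qed.

Lemma representable_const n : representable (fun _ => n).
Proof. by exists (Eq (Var 0) (numeral n)) => Q QR e y; rewrite /= eval_numeral. Qed.

Lemma representable_comp F (s : (nat -> nat) -> nat -> nat) : representable F ->
  (forall i, representable (fun e => s e i)) -> representable (fun e => F (s e)).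
Proof.
move=> /binumerable_graph hF hs; apply: representable_graph.
have := @binumerable_comp _ (fun e => scons (e 0) (s (fun i => e i.+1))) hF.
apply=> -[|i] /=; first exact: representable_var.
have [A hA] := hs i; exists (subst (scons (Var 0) (fun i => Var i.+2)) A) => Q QR e y.
by rewrite sat_subst -(hA Q QR); apply: sat_eqv => -[|j]; apply: eqv_refl.
Qed.

Lemma binumerable_eq F G : representable F -> representable G ->
  binumerable (fun e => F e = G e).
Proof.
move=> hF hG; have := @binumerable_comp (fun e => e 0 = e 1) (fun e => scons (F e) (fun _ => G e)).
apply=> [|[|i] //]; exists (Eq (Var 0) (Var 1)) => Q QR e; exact: qnum_inj.
Qed.

Lemma binumerable_le F G : representable F -> representable G ->
  binumerable (fun e => F e <= G e).
Proof.
move=> hF hG; have := @binumerable_comp (fun e => e 0 <= e 1) (fun e => scons (F e) (fun _ => G e)).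
apply=> [|[|i] //]; exists (Le (Var 0) (Var 1)) => Q QR e; rewrite sat_Le /= qle_num //.
split=> [[i le /(qnum_inj QR) ->]//|le]; exists (e 0) => //; exact: eqv_refl.
Qed.

Lemma representable_add F G : representable F -> representable G ->
  representable (fun e => F e + G e).
Proof.
move=> hF hG; have := @representable_comp (fun e => e 0 + e 1)
  (fun e => scons (F e) (fun _ => G e)).
apply=> [|[|i] //]; exists (Eq (Var 0) (Add (Var 1) (Var 2))) => Q QR e y.
rewrite sat_Eq eval_Add /=; split=> h; apply: eqv_trans h _; first exact: qadd_num.
by apply: eqv_sym; apply: qadd_num.
Qed.

Lemma representable_mul F G : representable F -> representable G ->
  representable (fun e => F e * G e).
Proof.
move=> hF hG; have := @representable_comp (fun e => e 0 * e 1)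
  (fun e => scons (F e) (fun _ => G e)).
apply=> [|[|i] //]; exists (Eq (Var 0) (Mul (Var 1) (Var 2))) => Q QR e y.
rewrite sat_Eq eval_Mul /=; split=> h; apply: eqv_trans h _; first exact: qmul_num.
by apply: eqv_sym; apply: qmul_num.
Qed.

Lemma representable_succ F : representable F -> representable (fun e => (F e).+1).
Proof.
move=> hF; apply: (@representable_eq (fun e => F e + 1)) => [e|]; first exact: addn1.
exact: representable_add hF (representable_const 1).
Qed.

(** The bound is taken to be a variable first, where [qle_num] restricts the quantifier to numerals;
    a general bound is then substituted. *)
Lemma binumerable_all_le F P : representable F -> binumerable P ->
  binumerable (fun e => forall x, x <= F e -> P (scons x e)).
Proof.
move=> hF [A hA].
have [B hB] : binumerable (fun e => forall x, x <= e 0 -> P (scons x (fun i => e i.+1))).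
  pose A' := subst (scons (Var 0) (fun i => Var i.+2)) A.
  exists (All (Imp (Le (Var 0) (Var 1)) A')) => Q QR e; set en := fun i => qnum Q (e i).
  have E z x : eqv z (qnum Q x) ->
      sat (scons z en) A' <-> P (scons x (fun i => e i.+1)).
    move=> zx; rewrite sat_subst -(hA Q QR) qnum_scons.
    by apply: sat_eqv => -[|i] //; apply: eqv_refl.
  have -> : sat en (All (Imp (Le (Var 0) (Var 1)) A'))
      = forall z, sat (scons z en) (Le (Var 0) (Var 1)) -> sat (scons z en) A' by [].
  split=> [h x le|h z /sat_Le/(qle_num QR)[x le zx]]; last by apply/(E _ _ zx)/h.
  apply/(E _ _ (eqv_refl _))/h/sat_Le/(qle_num QR).
  by exists x => //; apply: eqv_refl.
have := @binumerable_comp _ (fun e => scons (F e) e) (ex_intro _ B hB).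
by apply=> -[|i] //; apply: representable_var.
Qed.

Lemma binumerable_ex_le F P : representable F -> binumerable P ->
  binumerable (fun e => exists2 x, x <= F e & P (scons x e)).
Proof.
move=> hF hP; have := binumerable_not (binumerable_all_le hF (binumerable_not hP)).
apply: binumerable_iff => e; split=> [h|[x le Px] h]; last exact: h le Px.
by apply: NNPP => no; apply: h => x le Px; apply: no; exists x.
Qed.

Lemma representable_mod F G : representable F -> representable G ->
  representable (fun e => F e %% (G e).+1).
Proof.
move=> hF hG.
have [A hA] : representable (fun e => e 0 %% (e 1).+1).
  apply: representable_graph => /=.
  (* Remainder and quotient characterize [%%]; the quotient may be bounded by the dividend, which
     keeps the definition within bounded quantifiers. *)
  apply: (@binumerable_iff (fun e => e 0 <= e 2 /\
    exists2 q, q <= e 1 & e 1 = q * (e 2).+1 + e 0)).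
    move=> e; split=> [[lt [q _ ->]]|->]; first by rewrite modnMDl modn_small.
    split; first by rewrite -ltnS ltn_mod.
    by exists (e 1 %/ (e 2).+1); [apply: leq_div | apply: divn_eq].
  apply: binumerable_and; first by apply: binumerable_le; apply: representable_var.
  apply: (@binumerable_ex_le _ (fun e => e 2 = e 0 * (e 3).+1 + e 1)).
    exact: representable_var.
  apply: binumerable_eq; first exact: representable_var.
  apply: representable_add; last exact: representable_var.
  apply: representable_mul; first exact: representable_var.
  by apply: representable_succ; apply: representable_var.
have := @representable_comp _ (fun e => scons (F e) (fun _ => G e)) (ex_intro _ A hA).
by apply=> -[|i].
Qed.

End Representability.

(** * Goedel's beta function and primitive recursion *)

Definition beta (c d i : nat) : nat := c %% (i.+1 * d).+1.

(** Chinese remainder theorem for the moduli [f i]: they exceed the values [a i] and are pairwise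
    coprime. *)
Lemma beta_surj (a : nat -> nat) n : exists c d, forall i, i < n -> beta c d i = a i.
Proof.
(* As [b] bounds all [a i], its factorial makes each modulus large enough. As [b >= n], every
   difference [j - i] divides [d], and each [f i] is coprime to [d], hence to [f j - f i]. *)
pose b := maxn n (\max_(i < n) a i); pose d := b`!; pose f i := (i.+1 * d).+1.
have a_lt i : i < n -> a i < f i.
  move=> lt; rewrite ltnS; apply: leq_trans (leq_pmull d (ltn0Sn i)).
  apply: leq_trans (fact_geq b); apply: leq_trans (leq_maxr _ _).
  exact: (leq_bigmax (Ordinal lt)).
have cop_d i : coprime (f i) d by rewrite /f coprime_sym -addn1 /coprime gcdnMDl gcdn1.
have cop i j : i < j -> j < n -> coprime (f i) (f j).
  move=> ij jn.
  have -> : f j = f i + (j - i) * d by rewrite /f addSn -mulnDl addSn subnKC // ltnW.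
  rewrite /coprime gcdnDl -/(coprime _ _) coprimeMr cop_d andbT.
  apply: coprime_dvdr (cop_d i); apply: dvdn_fact; rewrite subn_gt0 ij /=.
  by apply: leq_trans (leq_subr _ _) _; apply: leq_trans (ltnW jn) (leq_maxl _ _).
have [c hc] : exists c, forall i, i < n -> c = a i %[mod f i].
  (* The induction is on the number of congruences already solved, with [n] kept fixed inside the
     moduli. *)
  have : n <= n by []; move: {-2}n; elim=> [|k IH] kn; first by exists 0.
  have [c hc] := IH (ltnW kn).
  have copk : coprime (\prod_(i < k) f i) (f k).
    elim/big_ind: _ => [|x y hx hy|i _]; first exact: coprime1n.
      by rewrite coprimeMl hx.
    exact: cop.
  exists (chinese (\prod_(i < k) f i) (f k) c (a k)) => i.
  rewrite ltnS leq_eqVlt => /orP[/eqP ->|lt]; first exact: chinese_modr.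
  have dv : f i %| \prod_(i < k) f i by rewrite (bigD1 (Ordinal lt)) //= dvdn_mulr.
  by rewrite -(modn_dvdm _ dv) chinese_modl // modn_dvdm // hc.
exists c, d => i lt; rewrite /beta -/(f i) hc // modn_small //; exact: a_lt.
Qed.

Lemma representable_beta F G H : representable F -> representable G -> representable H ->
  representable (fun e => beta (F e) (G e) (H e)).
Proof.
move=> hF hG hH; apply: representable_mod => //.
by apply: representable_mul => //; apply: representable_succ.
Qed.

Lemma least_exists (P : nat -> Prop) : (exists n, P n) ->
  exists n, P n /\ forall y, P y -> n <= y.
Proof.
case=> n; elim/ltn_ind: n => n IH Pn.
case: (classic (exists2 k, k < n & P k)) => [[k lt /(IH k lt)]//|no].
by exists n; split=> // y Py; rewrite leqNgt; apply/negP => lt; apply: no; exists y.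
Qed.

(* [c] and [d] code by [beta] the successive values of the recursion. *)
Lemma representable_iteri (F G : (nat -> nat) -> nat) : representable F -> representable G ->
  representable (fun e => iteri (e 0)
    (fun y r => G (scons y (scons r (fun i => e i.+1)))) (F (fun i => e i.+1))).
Proof.
move=> hF hG.
pose h (e : nat -> nat) k := iteri k
  (fun y r => G (scons y (scons r (fun i => e i.+1)))) (F (fun i => e i.+1)).
have var := representable_var.
(* The environment of [code] is c, d, s, e. *)
pose code (u : nat -> nat) := let e i := u i.+3 in
  beta (u 0) (u 1) 0 = F (fun i => e i.+1) /\
  forall i, i <= e 0 -> i < e 0 -> beta (u 0) (u 1) i.+1
    = G (scons i (scons (beta (u 0) (u 1) i) (fun i => e i.+1))).
have codeP u : code u <-> forall i, i <= u 3 -> beta (u 0) (u 1) i = h (fun i => u i.+3) i.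
  split=> [[c0 cS]|c].
    elim=> [//|i IH] lt; rewrite cS //; last exact: ltnW.
    by rewrite IH //; apply: ltnW.
  by split=> [|i _ lt]; rewrite !c //; apply: ltnW.
have bcode : binumerable code.
  apply: binumerable_and.
    apply: binumerable_eq.
      by apply: representable_beta (var 0) (var 1) (representable_const 0).
    by apply: (@representable_comp F (fun u i => u i.+4)) => // i; apply: var.
  (* The available quantifier is bounded by [<=]; the guard [i < e 0] in [code] removes the
     endpoint, where there is no next step to check. *)
  apply: (@binumerable_all_le (fun u => u 3)
    (fun v => v 0 < v 4 -> beta (v 1) (v 2) (v 0).+1
      = G (scons (v 0) (scons (beta (v 1) (v 2) (v 0)) (fun i => v i.+1.+4))))); first exact: var.
  apply: binumerable_imp.
    by apply: (@binumerable_le (fun v => (v 0).+1)) => //; apply: representable_succ.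
  apply: binumerable_eq.
    by apply: representable_beta => //; apply: representable_succ.
  apply: (@representable_comp G
    (fun v => scons (v 0) (scons (beta (v 1) (v 2) (v 0)) (fun i => v i.+1.+4)))) => //.
  by case=> [|[|i]] /=; [exact: var | exact: representable_beta | exact: var].
(* A single number bounding both [c] and [d] can be minimized, which avoids a pairing function; the
   pair is searched for again below that bound. *)
pose bounded_code (u : nat -> nat) := exists2 d, d <= u 0 &
  exists2 c, c <= u 0 & code (scons c (scons d u)).
have bbcode : binumerable bounded_code.
  apply: (@binumerable_ex_le _ (fun v => exists2 c, c <= v 1 & code (scons c v))); first exact: var.
  by apply: binumerable_ex_le => //; apply: var.
have ex_code e : exists s, bounded_code (scons s e).
  have [c [d cd]] := beta_surj (h e) (e 0).+1.
  exists (maxn c d); exists d; first exact: leq_maxr.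
  exists c; first exact: leq_maxl.
  by apply/codeP => i le /=; apply: cd.
pose s e := sval (constructive_indefinite_description _ (least_exists (ex_code e))).
have [s_code s_min] : (forall e, bounded_code (scons (s e) e)) /\
    (forall e y, bounded_code (scons y e) -> s e <= y).
  by split=> e; rewrite /s; case: (constructive_indefinite_description _ _) => /= ? [].
have rs := representable_min bbcode s_code s_min.
(* The environment of [graph] is s, y, e. *)
pose graph (v : nat -> nat) := exists2 d, d <= v 0 & exists2 c, c <= v 0 &
  code (scons c (scons d (scons (v 0) (fun i => v i.+2)))) /\ v 1 = beta c d (v 2).
have bgraph : binumerable graph.
  apply: (@binumerable_ex_le _ (fun w => exists2 c, c <= w 1 &
    code (scons c (scons (w 0) (scons (w 1) (fun i => w i.+3)))) /\
    w 2 = beta c (w 0) (w 3))); first exact: var.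
  apply: (@binumerable_ex_le _ (fun u =>
    code (scons (u 0) (scons (u 1) (scons (u 2) (fun i => u i.+4)))) /\
    u 3 = beta (u 0) (u 1) (u 4))); first exact: var.
  apply: binumerable_and; last by apply: binumerable_eq => //; apply: representable_beta.
  apply: (@binumerable_comp code
    (fun u => scons (u 0) (scons (u 1) (scons (u 2) (fun i => u i.+4))))) => //.
  by case=> [|[|[|i]]]; apply: var.
apply: representable_graph.
apply: (@binumerable_iff (fun e => graph (scons (s (fun i => e i.+1)) e))); last first.
  apply: (@binumerable_comp graph (fun e => scons (s (fun i => e i.+1)) e)) => //.
  by case=> [|i] /=; [apply: (@representable_comp s (fun e i => e i.+1)) | apply: var].
(* The pair [c], [d] need not be unique: by [codeP] every pair accepted by [code] gives the same
   value at the recursion argument. *)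
move=> e; split=> [[d _ [c _ [/codeP cd /= E]]]|/= E]; first by rewrite E; exact: cd.
have [d ds [c cs cd]] := s_code (fun i => e i.+1).
exists d => //; exists c => //; split=> //.
by rewrite /= E; move/codeP: cd => /= ->.
Qed.

Lemma tval_mktuple (e : nat -> nat) n : tval [tuple e i | i < n] = mkseq e n.
Proof. by rewrite /= /mkseq -val_enum_ord -map_comp. Qed.

Lemma mkseq_succ (e : nat -> nat) n : mkseq e n.+1 = e 0 :: mkseq (fun i => e i.+1) n.
Proof. by rewrite /mkseq /= -[1]addn0 iotaDl -map_comp. Qed.

Lemma mktuple_scons n y (e : nat -> nat) :
  [tuple of y :: [tuple e i | i < n]] = [tuple scons y e i | i < n.+1].
Proof.
apply: val_inj; transitivity (mkseq (scons y e) n.+1); last by rewrite -tval_mktuple.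
by rewrite mkseq_succ -tval_mktuple.
Qed.

(** Tuples are read as initial segments of environments. Regularity in [rec_min] is exactly what
    [representable_min] asks for. *)
Lemma representable_recursive n (f : n.-tuple nat -> nat) : recursive f ->
  representable (fun e => f [tuple e i | i < n]).
Proof.
have var := representable_var.
elim=> {n f} [n||n i|k n f g _ IHf _ IHg|n f g _ IHf _ IHg|n f h _ IHf fh].
- exact: representable_const.
- apply: representable_succ; apply: (representable_eq _ (var 0)) => e.
  by rewrite /thead tnth_mktuple.
- by apply: (representable_eq _ (var i)) => e; rewrite tnth_mktuple.
(* Entries beyond [k] get the default 0, which is representable as a constant. *)
- pose s (e : nat -> nat) := extend_fam 0 (fun i => g i [tuple e j | j < n]).
  apply: (@representable_eq (fun e => f [tuple s e i | i < k])) => [e|].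
    by congr f; apply: eq_mktuple => i; apply: extend_famE.
  apply: representable_comp IHf _ => i; rewrite /s /extend_fam.
  by case: insubP => [j _ _|_]; [apply: IHg | apply: representable_const].
- apply: representable_eq (representable_iteri IHf IHg) => e.
  have -> : thead [tuple e i | i < n.+1] = e 0 by rewrite /thead tnth_mktuple.
  have -> : [tuple of behead [tuple e i | i < n.+1]] = [tuple e i.+1 | i < n].
    apply: val_inj; transitivity (behead (mkseq e n.+1)); first by rewrite -tval_mktuple.
    by rewrite mkseq_succ /= -tval_mktuple.
  elim: (e 0) => //= y ->; rewrite -!mktuple_scons.
  by congr g; apply: val_inj.
- have fP := @binumerable_eq _ (fun _ => 0) IHf (representable_const 0).
  apply: (representable_min fP) => [e|e y]; rewrite -mktuple_scons.
    by case: (fh [tuple e i | i < n]).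
  case: (fh [tuple e i | i < n]) => _ min f0; rewrite leqNgt; apply/negP => lt.
  exact: min lt f0.
Qed.

(** * The truth predicate *)

Lemma models_R_models (Q : model arith) : models Q R -> models_R Q.
Proof. by move=> QR A RA; apply: (QR (Sentence (R_axiom_closed RA)) RA). Qed.

(** Index 0 is the output and index 1 the input. The bound 2 is what allows the formula to define a
    predicate of exactly one block of arguments. *)
Lemma recursive1_formula eta : recursive1 eta ->
  exists2 A : form arith, bounded 2 A &
    forall (Q : model arith) n (e : nat -> Q), models_R Q -> eqv (e 1) (qnum Q n) ->
      sat e A <-> eqv (e 0) (qnum Q (eta n)).
Proof.
case/representable_recursive => A hA.
(* Identifies all inputs with variable 1; this is correct since [hA] is used at the constant
   environment [n]. *)
exists (subst (fun i => Var (minn i 1)) A).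
  by apply: bounded_subst (bounded_bound (leqnn _)) => -[|i].
move=> Q n e QR en; have := hA Q QR (fun _ => n) (e 0).
rewrite /thead tnth_mktuple sat_subst => <-.
by apply: sat_eqv => -[|i]; [apply: eqv_refl | rewrite /= minnSS minn0].
Qed.

Section Reduct.
Variables (L E : signature) (M : model (sig_sum L E)).

Definition reduct : model L :=
  @Model L M (@eqv _ M) (fun f => @fint _ M (inl f)) (fun P => @pint _ M (inl P))
    (@eqv_refl _ M) (@eqv_sym _ M) (@eqv_trans _ M)
    (fun f => @fint_eqv _ M (inl f)) (fun P => @pint_eqv _ M (inl P)).

Lemma eval_embed (e : nat -> M) t : eval e (embed_tm E t) = @eval L reduct e t.
Proof.
elim: t => //= f ts IH; congr fint.
by apply: functional_extensionality => i; apply: IH.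
Qed.

Lemma sat_embed (e : nat -> M) A : sat e (embed E A) <-> @sat L reduct e A.
Proof.
elim: A e => [|s t|P ts|A IHA B IHB|A IHA] e //=.
- by rewrite !eval_embed.
- have -> // : (fun i => eval e (embed_tm E (ts i))) = fun i => @eval L reduct e (ts i).
  by apply: functional_extensionality => i; apply: eval_embed.
- by rewrite IHA IHB.
- by split=> h x; apply/IHA.
Qed.

Lemma models_reduct U Gamma : models M (extend U Gamma) -> models reduct U.
Proof.
move=> MU A UA e; apply/sat_embed; apply: (MU (embed_sentence E A)).
by left; exists A.
Qed.

End Reduct.

(** * The redefined truth predicate *)

Section TruthPredicate.
Variables (L : signature) (N : translation arith L).
Local Notation m := (dim N).
Local Notation LT := (sig_sum L (pred_sig m)).

(** Common shape of [T_num], with [is_numeral n] for [A], and of the new truth predicate, with [phi]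
    for [A]. *)
Definition T_exists (A : form arith) : form LT :=
  exs m (And (embed _ (tr_dom N))
    (And (embed _ (tr N A)) (@Rel LT (inr tt) (fun i => Var i)))).

Lemma T_exists_bounded n A : bounded n.+1 A -> bounded (n * m) (T_exists A).
Proof.
move=> bA; rewrite bounded_exs !bounded_And !bounded_embed.
rewrite (bounded_mono _ (tr_dom_bounded N)) ?leq_addr //= -mulSn bounded_tr //.
by apply/forallP => i /=; rewrite mulSn ltn_addr.
Qed.

(** Under the quantifiers block 0 is the new tuple and block [i + 1] is block [i] of [e], so the
    parameters of [A] are the elements named there. The cases used are [n = 0] for [T_num] and
    [n = 1] for [phi]. *)
Lemma sat_T_exists (M : model LT) (Q : model arith) (r : Q -> nat -> reduct M) n A
    (e : nat -> M) (es : nat -> Q) :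
  realizes N r -> bounded n.+1 A ->
  (forall i j, i < n -> j < m -> e (i * m + j) = r (es i) j) ->
  sat e (T_exists A) <->
  exists k, sat (scons k es) A /\ @pint LT M (inr tt) (fun i => r k i).
Proof.
move=> rz bA ee; rewrite sat_exs.
have T_of w k : (forall j, j < m -> w j = r k j) ->
    @pint LT M (inr tt) (fun i => prepend m w e i) = @pint LT M (inr tt) (fun i => r k i).
  move=> wk; congr pint; apply: functional_extensionality => i.
  by rewrite prepend_lt // wk.
have A_of w k : (forall j, j < m -> w j = r k j) ->
    @sat L (reduct M) (prepend m w e) (tr N A) <-> sat (scons k es) A.
  move=> wk; rewrite -(sat_tr rz).
  apply: (sat_bounded (bounded_tr N bA)) => v; rewrite /prepend mulSn.
  case: (ltnP v m) => [lt _|le].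
    by rewrite /blocks (divn_small lt) (modn_small lt) wk //; apply: eqv_refl.
  rewrite -ltn_subLR // => lt.
  have Ev : v = 1 * m + (v - m) by rewrite mul1n subnKC.
  rewrite /blocks {2 3}Ev divnMDl ?dim_gt0 // modnMDl add1n /=.
  rewrite {1}(divn_eq (v - m) m) ee ?ltn_divLR ?ltn_mod ?dim_gt0 //; exact: eqv_refl.
have D_of w : @sat L (reduct M) (prepend m w e) (tr_dom N) <-> @in_dom _ _ N (reduct M) w.
  by apply: (sat_bounded (tr_dom_bounded N)) => i lt; rewrite prepend_lt //; apply: eqv_refl.
split=> [[w]|[k [Ak Tk]]].
  rewrite !sat_And !sat_embed D_of => -[/(realizes_dom_eq rz)[k wk] [Aw Tw]].
  by exists k; split; [apply/(A_of w) | rewrite -(T_of w)].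
exists (r k); rewrite !sat_And !sat_embed D_of; split; first exact: (realizes_in_dom rz).
split; first exact/(A_of _ k).
by rewrite /= (T_of _ k).
Qed.

Variable phi : form arith.
Hypothesis phi_bounded : bounded 2 phi.

(** This formula, [pull_pred] and [pull_func] have the literal shapes demanded by
    [identity_preserving] and [fixes_signature], so that these conditions hold by computation. *)
Definition pull_eq : form LT := \big[@And LT/Top]_(j < 1) Eq (Var j) (Var (1 + j)).

Definition pull_pred (P : psym LT) : form LT :=
  match P with
  | inl P => @Rel LT (inl P) (fun i => Var i)
  | inr _ => T_exists phi
  end.

Definition pull_func (f : fsym LT) : form LT := Eq (App f (fun i => Var i)) (Var (far f)).

Lemma pull_eq_bounded : bounded (2 * 1) pull_eq.
Proof. by apply: bounded_bigAnd => i; rewrite ord1. Qed.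

Lemma pull_pred_bounded P : bounded (par P * 1) (pull_pred P).
Proof.
case: P => [P|[]]; first by apply/forallP => i; rewrite /= muln1.
by rewrite /= muln1; have := T_exists_bounded phi_bounded; rewrite mul1n.
Qed.

Lemma pull_func_bounded f : bounded ((far f).+1 * 1) (pull_func f).
Proof. by rewrite muln1 /= ltnSn andbT; apply/forallP => i; apply: leqW (ltn_ord i). Qed.

Definition pull_translation : translation LT LT :=
  @Translation LT LT 1 isT Top pull_eq pull_pred pull_func isT
    pull_eq_bounded pull_pred_bounded pull_func_bounded.

Section Expansion.
Variables (M : model LT) (x0 : M).

(** The default [x0] is invisible, as [T_exists phi] only sees the first block of variables. *)
Definition pull_T (u : 'I_m -> M) : Prop := sat (extend_fam x0 u) (T_exists phi).

Lemma pull_T_eqv u v : (forall i, eqv (u i) (v i)) -> pull_T u -> pull_T v.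
Proof.
move=> uv; apply: iffLR; apply: sat_eqv => i; rewrite /extend_fam.
by case: insubP => [j _ _|_]; [apply: uv | apply: eqv_refl].
Qed.

Definition pull_pint (P : psym LT) : ('I_(par P) -> M) -> Prop :=
  match P with inl P => @pint LT M (inl P) | inr _ => pull_T end.

(** Only the truth predicate changes. The case split in the last field makes the reduct to [L]
    convertible with that of [M], so the same structure for R and the same names serve both
    models. *)
Definition pull_model : model LT :=
  @Model LT M (@eqv _ M) (@fint _ M) pull_pint
    (@eqv_refl _ M) (@eqv_sym _ M) (@eqv_trans _ M) (@fint_eqv _ M)
    (fun P => match P with
     | inl P => @pint_eqv LT M (inl P)
     | inr _ => pull_T_eqv
     end).

Lemma realizes_pull : @realizes _ _ pull_translation M pull_model (fun k _ => k).
Proof.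
have b1 (e : nat -> M) : blocks 1 (fun i _ => e i) = e.
  by apply: functional_extensionality => v; rewrite /blocks divn1.
split.
- by move=> v; split=> [_|_ []]; exists (v 0) => -[].
- move=> e; rewrite b1 sat_bigAnd; split=> [/(_ ord0)//|h i]; by rewrite ord1.
- move=> [P|[]] e; rewrite b1 //.
  rewrite /= /pull_T; apply: (sat_bounded (T_exists_bounded phi_bounded)) => i.
  rewrite mul1n => lt; rewrite (extend_famE _ _ (Ordinal lt)); exact: eqv_refl.
- by move=> f e; rewrite b1.
- move=> f e; pose k : M := @fint LT M f (fun i => e i); exists k.
  pose es := prepend (far f) (fun i (_ : nat) => e i : M) (fun _ _ => k).
  suff : eqv (@fint LT M f (fun i => blocks 1 es i)) (blocks 1 es (far f)) by [].
  have b v : blocks 1 es v = es v 0 by rewrite /blocks divn1 modn1.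
  have -> : (fun i : 'I_(far f) => blocks 1 es i) = fun i => e i.
    by apply: functional_extensionality => i; rewrite b /es prepend_lt.
  by rewrite b /es /prepend ltnn; apply: eqv_refl.
Qed.

End Expansion.
End TruthPredicate.

Lemma fujimoto_TB (L : signature) (U : theory L) (nu0 nu1 : goedel_numbering L) eta
    (N : translation arith L) :
  recursive1 eta -> nu0 =1 eta \o nu1 -> interprets N R U ->
  fujimoto U (TB N nu0) (TB N nu1).
Proof.
case/recursive1_formula => phi bphi phiP hnu NR.
exists (pull_translation N bphi); split=> //.
apply: realizes_interprets => M x0 MU.
exists (pull_model phi x0), (fun k _ => k).
split; [exact: realizes_pull | exact: (inhabits x0) |].
have [Q [r [rz [q0] /models_R_models QR]]] :=
  @interprets_model _ _ N _ _ (reduct M) x0 NR (models_reduct MU).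
(* Stated for an arbitrary [M'] because it is needed for the old truth predicate and for the new
   one. *)
have num n (M' : model (sig_sum L (pred_sig (dim N)))) (e : nat -> M')
    (r' : Q -> nat -> reduct M') : realizes N r' ->
    sat e (T_num N n) <->
    exists k, eqv k (qnum Q n) /\ @pint _ M' (inr tt) (fun i => r' k i).
  move=> rz'; rewrite (@sat_T_exists _ _ M' Q r' 0 _ e (fun _ => q0) rz' (bounded_is_numeral n)) //.
  by split=> -[k [kn Tk]]; exists k; split=> //; move: kn; rewrite sat_is_numeral.
have pull k : pull_T phi x0 (fun i => r k i) <->
    exists p, sat (scons p (fun _ => k)) phi /\ @pint _ M (inr tt) (fun i => r p i).
  apply: (@sat_T_exists _ _ M Q r 1) => // -[|//] j _ jm.
  by rewrite (extend_famE _ _ (Ordinal jm)).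
move=> B [[A UA ->]|[A ->]] e.
  by apply/sat_embed; apply: (models_reduct MU).
rewrite sat_Iff (num _ (pull_model phi x0) e r rz) sat_embed.
have /sat_Iff : sat (M := M) e (TB_form N nu0 A).
  by apply: (MU (Sentence (TB_closed N nu0 A))); right; exists A.
rewrite sat_embed (num _ M e r rz) hnu => ->.
(* Both sides now say that the old predicate holds of an element equal to the numeral of
   [eta (nu1 A)]; [phi] leads there from the numeral of [nu1 A]. *)
split=> [[p [pn Tp]]|[k [kn /pull[p [/(phiP _ (nu1 A) _ QR kn) pn Tp]]]]]; last by exists p.
exists (qnum Q (nu1 A)); split; first exact: eqv_refl.
by apply/pull; exists p; split=> //; apply/(phiP _ (nu1 A)) => //; apply: eqv_refl.
Qed.

Theorem theorem3p6 (L : signature) (U : theory L)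
    (nu0 nu1 : goedel_numbering L) (eta : nat -> nat)
    (heta : recursive1 eta) (hnu : nu0 =1 eta \o nu1) :
  (forall N : translation arith L,
     interprets N R U -> fujimoto U (TB N nu0) (TB N nu1)) /\
  (vaught U -> enayat U nu0 -> enayat U nu1).
Proof.
split=> [N|_ [N NR TB0]]; first exact: (fujimoto_TB heta hnu).
exists N => //; apply: interpretable_trans TB0.
by have [F [FI _ _ _]] := fujimoto_TB heta hnu NR; exists F.
Qed.
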